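(* Consider the individual-sum controlled branching process $(X_n)$ of the context. Conditional on the environmental sequence $\{(A_n,B_n):n\ge0\}$, $(X_n)$ is a branching process in random environment with immigration: $$X_{n+1}=\sum_{i=1}^{X_n}Y_{n,i}^{(A_n)}+\eta_{n+1}^{(B_n)},$$ where, given $A_n=a$ and $B_n=b$, $Y_{n,i}^{(a)}$ has the law of $\sum_{r=1}^{aL_{n,i}}\xi_{n,i,r}$ and $\eta_{n+1}^{(b)}$ has the law of $\sum_{r=1}^b\xi'_{n,r}$ (with $\xi_{n,i,r},\xi'_{n,r}$ independent copies of $\xi$, independent of the $L$'s), all the $Y_{n,i}^{(a)}$, $i\ge1$, and $\eta_{n+1}^{(b)}$ being conditionally independent. Their conditional probability generating functions are $$\mathbf E[s^{Y_{n,i}^{(a)}}\mid A_n=a]=\ell(f(s)^a),\qquad\mathbf E[s^{\eta_{n+1}^{(b)}}\mid B_n=b]=f(s)^b,$$ the induced quenched reproduction mean is $m\lambda A_n$, and the quenched generating functions $F_n^{\mathcal E}(s):=\mathbf E[s^{X_n}\mid(A_j,B_j)_{j\ge0}]$ satisfy $$F_{n+1}^{\mathcal E}(s)=f(s)^{B_n}\,F_n^{\mathcal E}\bigl(\ell(f(s)^{A_n})\bigr).$$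
   Context: Individual-sum controlled branching process: $\xi_{n,j}$ ($n\ge0$, $j\ge1$) are i.i.d. copies of a nonnegative integer-valued $\xi$ with mean $m\in(0,\infty)$ and probability generating function $f(s)=\mathbf E[s^\xi]$; $(A_n,B_n)$, $n\ge0$, are i.i.d. with $A_n\in\{1,2,\dots\}$ and $B_n\in\{0,1,\dots\}$ ($A_n$ and $B_n$ possibly dependent); $L_{n,j}$ are i.i.d. copies of a nonnegative integer-valued $L$ with mean $\lambda\in(0,\infty)$ and probability generating function $\ell(s)=\mathbf E[s^L]$. These families and the initial state $X_0$ are independent. The process is $X_{n+1}=\sum_{j=1}^{N_n}\xi_{n,j}$ with $N_n=A_n\sum_{j=1}^{X_n}L_{n,j}+B_n$. The representation is understood after relabelling the offspring array, i.e. as an identity in law of the conditional transition mechanism given the environment. *)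

(* Defs.v *)
From HB Require Import structures.
From mathcomp Require Import all_boot all_order all_algebra finmap.
From mathcomp Require Import all_classical all_reals all_analysis measurable_realfun.

Set Implicit Arguments.
Unset Strict Implicit.
Unset Printing Implicit Defensive.

Import Order.TTheory GRing.Theory Num.Theory.
Import numFieldNormedType.Exports.

Local Open Scope classical_set_scope.
Local Open Scope ring_scope.

Section Laws.
Context (R : realType).

Definition nat_mean (mu : probability nat R) : \bar R :=
  (\int[mu]_k (k%:R)%:E)%E.

(* For s in [0, 1] the integrand lies in [0, 1], so that [fine] loses
   nothing; 0 ^+ 0 = 1. *)
Definition pgf (mu : probability nat R) (s : R) : R :=
  fine (\int[mu]_k (s ^+ k)%:E)%E.

End Laws.

Section Conditioning.
Context d (T : measurableType d) (R : realType) (P : probability T R).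

Definition sigma_of d' (V : measurableType d') (Z : T -> V) : set_system T :=
  preimage_set_system setT Z measurable.

Definition mutual_independence (I : choiceType) (F : I -> set_system T) : Prop :=
  forall (J : {fset I}) (E : I -> set T),
    (forall i, i \in J -> F i (E i)) ->
    P (\bigcap_(i in [set` J]) E i) = (\prod_(i <- J) P (E i))%E.

(* [g] is a version of the conditional expectation of [f] given the
   sigma-algebra [G], for [f] with values in [0, +oo]; integrability is not
   required, so that infinite conditional means make sense. *)
Definition is_condexp (G : set_system T) (f g : T -> \bar R) : Prop :=
  [/\ (forall t, 0 <= g t)%E,
      (forall D : set (\bar R), measurable D -> G (g @^-1` D)) &
      (forall C, G C -> \int[P]_(t in C) g t = \int[P]_(t in C) f t)%E].

Definition is_condprob (G : set_system T) (C : set T) (g : T -> \bar R) : Prop :=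
  is_condexp G (fun t => (\1_C t)%:E) g.

(* The elementary conditional expectation E[f | C], for an event C of
   positive probability. *)
Definition condexp_event (C : set T) (f : T -> R) : R :=
  (\int[P]_(t in C) f t) / fine (P C).

Definition conditional_independence (G : set_system T) (I : choiceType)
    (Z : I -> T -> nat) : Prop :=
  forall (J : {fset I}) (D : I -> set nat) (p : I -> T -> R),
    (forall i, i \in J -> is_condprob G (Z i @^-1` D i) (EFin \o p i)) ->
    is_condprob G (\bigcap_(i in [set` J]) (Z i @^-1` D i))
                  (fun t => (\prod_(i <- J) p i t)%:E).

End Conditioning.

Section ControlledBranching.
Context d (T : measurableType d) (R : realType) (P : probability T R).

(* The index j >= 1 of the sums is shifted to j >= 0 throughout. *)

Definition individual_sum_control (L : nat -> nat -> T -> nat)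
    (A B X : nat -> T -> nat) (n : nat) (t : T) : nat :=
  (A n t * (\sum_(j < X n t) L n j t) + B n t)%N.

Variant source :=
  | Offspring of nat & nat
  | Control of nat & nat
  | Environment of nat
  | Initial.

Definition source_code (i : source) : (nat * nat) + (nat * nat) + nat + unit :=
  match i with
  | Offspring n j => inl (inl (inl (n, j)))
  | Control n j => inl (inl (inr (n, j)))
  | Environment n => inl (inr n)
  | Initial => inr tt
  end.

Definition source_decode (c : (nat * nat) + (nat * nat) + nat + unit) : source :=
  match c with
  | inl (inl (inl (n, j))) => Offspring n j
  | inl (inl (inr (n, j))) => Control n j
  | inl (inr n) => Environment n
  | inr _ => Initial
  end.

Lemma source_codeK : cancel source_code source_decode.
Proof. by case. Qed.

HB.instance Definition _ := Choice.copy source (can_type source_codeK).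

(* i.i.d. families that are independent of one another and of X_0 amount to
   the mutual independence of all their members together.  A_n and B_n may be
   dependent: only the pair is a member. *)
Definition cbp_source (xi L : nat -> nat -> T -> nat) (A B X : nat -> T -> nat)
    (i : source) : set_system T :=
  match i with
  | Offspring n j => sigma_of (xi n j)
  | Control n j => sigma_of (L n j)
  | Environment n => sigma_of (fun t => (A n t, B n t))
  | Initial => sigma_of (X 0)
  end.

Record individual_sum_cbp (mu nu : probability nat R) (m lambda : R)
    (xi L : nat -> nat -> {RV P >-> nat}) (A B X : nat -> {RV P >-> nat}) :
    Prop := {
  cbp_mean_gt0 : 0 < m ;
  cbp_mean : nat_mean mu = m%:E ;
  cbp_control_mean_gt0 : 0 < lambda ;
  cbp_control_mean : nat_mean nu = lambda%:E ;
  cbp_offspring_law : forall n j D, P (xi n j @^-1` D) = mu D ;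
  cbp_control_law : forall n j D, P (L n j @^-1` D) = nu D ;
  cbp_env_law : forall n (D : set (nat * nat)),
    P [set t | D (A n t, B n t)] = P [set t | D (A 0 t, B 0 t)] ;
  cbp_env_gt0 : forall n t, (0 < A n t)%N ;
  cbp_independence : mutual_independence P (cbp_source xi L A B X) ;
  cbp_rec : forall n t,
    X n.+1 t = (\sum_(j < individual_sum_control L A B X n t) xi n j t)%N
}.

Definition env_sigma (A B : nat -> T -> nat) : set_system T :=
  <<s \bigcup_n sigma_of (fun t => (A n t, B n t)) >>.

Definition env_past_sigma (A B X : nat -> T -> nat) (n : nat) : set_system T :=
  <<s (\bigcup_k sigma_of (fun t => (A k t, B k t))) `|`
      (\bigcup_(k in [set k | (k <= n)%N]) sigma_of (X k)) >>.

Variant copy_source :=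
  | CopyOffspring of nat & nat & nat
  | CopyImmigrant of nat & nat
  | CopyControl of nat & nat
  | CopyEnvironment of nat.

Definition copy_code (i : copy_source) :
    (nat * nat * nat) + (nat * nat) + (nat * nat) + nat :=
  match i with
  | CopyOffspring n j r => inl (inl (inl (n, j, r)))
  | CopyImmigrant n r => inl (inl (inr (n, r)))
  | CopyControl n j => inl (inr (n, j))
  | CopyEnvironment n => inr n
  end.

Definition copy_decode
    (c : (nat * nat * nat) + (nat * nat) + (nat * nat) + nat) : copy_source :=
  match c with
  | inl (inl (inl (n, j, r))) => CopyOffspring n j r
  | inl (inl (inr (n, r))) => CopyImmigrant n r
  | inl (inr (n, j)) => CopyControl n j
  | inr n => CopyEnvironment n
  end.

Lemma copy_codeK : cancel copy_code copy_decode.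
Proof. by case. Qed.

HB.instance Definition _ := Choice.copy copy_source (can_type copy_codeK).

(* [xi1 n i r] and [xi2 n r] are the relabelled offspring variables
   xi_{n,i,r} and xi'_{n,r}: independent copies of xi, independent of the
   L's and of the environment. *)
Record offspring_copies (mu : probability nat R)
    (L : nat -> nat -> {RV P >-> nat}) (A B : nat -> {RV P >-> nat})
    (xi1 : nat -> nat -> nat -> {RV P >-> nat})
    (xi2 : nat -> nat -> {RV P >-> nat}) : Prop := {
  copies_offspring_law : forall n i r D, P (xi1 n i r @^-1` D) = mu D ;
  copies_immigrant_law : forall n r D, P (xi2 n r @^-1` D) = mu D ;
  copies_independence : mutual_independence P (fun i : copy_source =>
    match i with
    | CopyOffspring n j r => sigma_of (xi1 n j r)
    | CopyImmigrant n r => sigma_of (xi2 n r)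
    | CopyControl n j => sigma_of (L n j)
    | CopyEnvironment n => sigma_of (fun t => (A n t, B n t))
    end)
}.

(* Y_{n,i}^{(a)} *)
Definition offspring_sum (L : nat -> nat -> T -> nat)
    (xi1 : nat -> nat -> nat -> T -> nat) (a n i : nat) (t : T) : nat :=
  (\sum_(r < a * L n i t) xi1 n i r t)%N.

(* eta_{n+1}^{(b)} *)
Definition immigrant_sum (xi2 : nat -> nat -> T -> nat) (b n : nat) (t : T) :
    nat :=
  (\sum_(r < b) xi2 n r t)%N.

(* Conditionally on the environment (A_n, B_n), X is a branching process in
   random environment with immigration, in which, in the environment (a, b),
   the i-th individual of generation n has a number of offspring distributed
   as [Y a n i] and the number of immigrants is distributed as [eta b n].  The
   identity X_{n+1} = sum_(i < X_n) Y_{n,i}^{(A_n)} + eta_{n+1}^{(B_n)} is one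
   between conditional transition laws ([bprei_transition]); conditioning on
   X_0, ..., X_n besides the whole environment expresses the Markov property
   of X given the environment. *)
Record bprei (A B X : nat -> T -> nat) (Y : nat -> nat -> nat -> T -> nat)
    (eta : nat -> nat -> T -> nat) : Prop := {
  bprei_offspring_ident : forall a n i D,
    P (Y a n i @^-1` D) = P (Y a 0 0 @^-1` D) ;
  bprei_immigrant_ident : forall b n D,
    P (eta b n @^-1` D) = P (eta b 0 @^-1` D) ;
  bprei_offspring_law : forall n i D,
    is_condprob P (env_sigma A B) [set t | D (Y (A n t) n i t)]
      (fun t => P (Y (A n t) n i @^-1` D)) ;
  bprei_immigrant_law : forall n D,
    is_condprob P (env_sigma A B) [set t | D (eta (B n t) n t)]
      (fun t => P (eta (B n t) n @^-1` D)) ;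
  bprei_independence :
    conditional_independence P (env_sigma A B)
      (fun i : (nat * nat) + nat => fun t =>
         match i with
         | inl (n, i) => Y (A n t) n i t
         | inr n => eta (B n t) n t
         end) ;
  bprei_initial : forall D,
    is_condprob P (env_sigma A B) (X 0 @^-1` D) (fun=> P (X 0 @^-1` D)) ;
  bprei_transition : forall n D,
    is_condprob P (env_past_sigma A B X n) (X n.+1 @^-1` D)
      (fun t => P [set u |
         D (\sum_(i < X n t) Y (A n t) n i u + eta (B n t) n u)%N])
}.

(* [F n s] is, for every n and s in [0, 1], a version of
   E[s ^ X_n | (A_j, B_j)_{j >= 0}]. *)
Definition quenched_pgf (A B X : nat -> T -> nat) (F : nat -> R -> T -> R) :
    Prop :=
  forall n s, 0 <= s <= 1 ->
    is_condexp P (env_sigma A B) (fun t => (s ^+ X n t)%:E)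
      (fun t => (F n s t)%:E).

End ControlledBranching.

(* Main.v *)
(** Everything is integer-valued, so conditioning on a variable [W] measurable
    for a sigma-algebra [G] reduces to freezing it: on [W = k] an expression
    [Z (W t) t] is [Z k t], and if the family [Z k] is independent of [G] then
    [t |-> E (psi (Z (W t)))] is a version of E[psi (Z W) | G].  The
    independence needed, between sigma-algebras generated by disjoint parts of
    a mutually independent family, follows from the pi-lambda theorem.

    The expectation of [psi] at a sum of [n] i.i.d. variables depends only on
    [n] and on their law ([sum_expect]).  Given the control variables L, both
    the step of the process and the relabelled sum of the Y's and eta are sums
    of [a * (L_1 + ... + L_x) + b] independent copies of xi, hence their
    transition laws agree.  Taking [psi k = s ^+ k] and freezing
    [(X n, A n, B n)] gives the quenched recursion, first for
    E[s ^ X_(n+1) | environment, X_0, ..., X_n], then for any version of the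
    quenched generating functions by almost sure uniqueness. *)

Require Import Defs.
From HB Require Import structures.
From mathcomp Require Import all_boot all_order all_algebra finmap.
From mathcomp Require Import all_classical all_reals all_analysis measurable_realfun.
Set Implicit Arguments.
Unset Strict Implicit.
Unset Printing Implicit Defensive.
Import Order.TTheory GRing.Theory Num.Theory.
Import numFieldNormedType.Exports.
Local Open Scope classical_set_scope.
Local Open Scope ring_scope.

(** * Independence of sigma-algebras generated by disjoint subfamilies *)

Section Independence.
Context d (T : measurableType d) (R : realType) (P : probability T R).

Definition indep_sys (G H : set_system T) : Prop :=
  forall A B, G A -> H B -> P (A `&` B) = (P A * P B)%E.

Lemma indep_sysC (G H : set_system T) : indep_sys G H -> indep_sys H G.
Proof. by move=> GH A B HA GB; rewrite setIC GH// muleC. Qed.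

(** For fixed [B] in [H], the maps sending [A] to [P (A]&[B)] and to [P A * P B] are finite measures
    that agree on the pi-system [G], hence on the sigma-algebra it generates. *)
Lemma indep_sys_salgebral (G H : set_system T) :
  setI_closed G -> G setT -> G `<=` measurable -> H `<=` measurable ->
  indep_sys G H -> indep_sys <<s G >> H.
Proof.
move=> GI GT Gm Hm GH A B sA HB.
have mB := Hm _ HB.
have P_B : P B \is a fin_num := fin_num_measure P _ mB.
have fP_B : 0 <= fine (P B) by exact: fine_ge0.
pose m1 := mrestr P mB.
pose m2 := mscale (NngNum fP_B) P.
suff: m1 A = m2 A.
  by rewrite /m1 /m2 /mrestr /mscale/= fineK// muleC.
apply: (g_sigma_algebra_measure_unique G Gm (fun=> setT)) => //.
- by rewrite bigcup_const.
- move=> C GC; rewrite /= /m1 /m2 /mrestr /mscale/= fineK// muleC.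
  exact: GH.
- move=> _; rewrite /= /m1 /mrestr setTI -ge0_fin_numE//.
Qed.

Lemma mutual_independence_reindex (I J : choiceType) (F : I -> set_system T)
    (c : J -> I) :
  injective c -> mutual_independence P F ->
  mutual_independence P (fun j => F (c j)).
Proof.
move=> c_inj indF K E FE.
(* [E'] transports [E] along [c] without an inverse of [c]: by injectivity the intersection has at
   most one member, and off the image of [K] it is empty and gives the whole space. *)
pose E' i := \bigcap_(j in [set j | j \in K /\ c j = i]) E j.
have E'c j : j \in K -> E' (c j) = E j.
  move=> jK; rewrite /E'; apply/seteqP; split => t; first by apply.
  by move=> Et k [_ /c_inj->].
have -> : \bigcap_(j in [set` K]) E j =
    \bigcap_(i in [set` [fset c j | j in K]%fset]) E' i.
  apply/seteqP; split => t Et.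
    by move=> i _ j [jK _]; exact: Et.
  by move=> j /= jK; rewrite -E'c//; apply: Et => /=; apply/imfsetP; exists j.
rewrite indF; last first.
  by move=> _ /imfsetP[j /= jK ->]; rewrite E'c//; exact: FE.
rewrite big_imfset/=; last by move=> ? ? _ _; exact: c_inj.
by apply: eq_big_seq => j jK; rewrite E'c.
Qed.

Section Family.
Context (I : choiceType) (F : I -> set_system T).
Hypothesis Fm : forall i, F i `<=` measurable.
Hypothesis FT : forall i, F i setT.
Hypothesis FI : forall i, setI_closed (F i).
Hypothesis indF : mutual_independence P F.

Definition family_salgebra (S : set I) : set_system T :=
  <<s \bigcup_(i in S) F i >>.

Lemma family_salgebra_measurable (S : set I) :
  family_salgebra S `<=` measurable.
Proof.
apply: smallest_sub; first exact: sigma_algebra_measurable.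
by move=> A [i _ /Fm].
Qed.

Lemma sub_family_salgebra (S : set I) i : S i -> F i `<=` family_salgebra S.
Proof. by move=> Si A FA; apply: sub_sigma_algebra; exists i. Qed.

Lemma family_salgebraS (S S' : set I) : S `<=` S' ->
  family_salgebra S `<=` family_salgebra S'.
Proof.
move=> SS'; apply: smallest_sub; first exact: smallest_sigma_algebra.
by move=> A [i /SS' Si FA]; exact: sub_family_salgebra FA.
Qed.

(** The pi-system that generates [family_salgebra S] and on which the product formula [indF] can be
    read off directly. *)
Let cylinder (S : set I) : set_system T :=
  [set C | exists J : {fset I}, exists E : I -> set T,
     [/\ [set` J] `<=` S, forall i, i \in J -> F i (E i) &
         C = \bigcap_(i in [set` J]) E i] ].

Let cylinderT (S : set I) : cylinder S setT.
Proof.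
exists fset0, (fun=> setT); split => //.
by apply/seteqP; split.
Qed.

Let cylinderI (S : set I) : setI_closed (cylinder S).
Proof.
move=> _ _ [J1 [E1 [J1S FE1 ->]]] [J2 [E2 [J2S FE2 ->]]].
(* The index sets may overlap: on a common index the two constraints are intersected, and a missing
   constraint is filled in by [setT]. *)
exists (J1 `|` J2)%fset, (fun i =>
  (if i \in J1 then E1 i else setT) `&` (if i \in J2 then E2 i else setT)).
split.
- by move=> i /=; rewrite inE => /orP[/J1S|/J2S].
- move=> i _; apply: FI; first by case: ifPn => // /FE1.
  by case: ifPn => // /FE2.
- apply/seteqP; split => t.
    by move=> [t1 t2] i _; split; case: ifPn => // iJ; [exact: t1|exact: t2].
  move=> tE; split => i /= iJ.
    by have := tE i; rewrite /= inE iJ /= => /(_ isT)[].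
  by have := tE i; rewrite /= inE iJ orbT => /(_ isT)[].
Qed.

Let cylinder_measurable (S : set I) : cylinder S `<=` measurable.
Proof.
move=> _ [J [E [_ FE ->]]]; rewrite bigcap_fset.
rewrite big_seq; elim/big_ind: _ => //.
  by move=> A B mA mB; exact: measurableI.
by move=> i /FE/Fm.
Qed.

Let cylinder_indep (S1 S2 : set I) : S1 `&` S2 = set0 ->
  indep_sys (cylinder S1) (cylinder S2).
Proof.
move=> S12 _ _ [J1 [E1 [J1S FE1 ->]]] [J2 [E2 [J2S FE2 ->]]].
have J12 i : i \in J1 -> i \in J2 -> False.
  move=> /J1S S1i /J2S S2i.
  by have : (S1 `&` S2) i by []; rewrite S12.
(* Since [J1] and [J2] are disjoint, the two cylinders merge into a single one, whose product over
   the union then splits into the two factors. *)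
pose E i := if i \in J1 then E1 i else E2 i.
have EJ2 i : i \in J2 -> E i = E2 i.
  by rewrite /E => iJ2; case: ifPn => // iJ1; have := J12 _ iJ1 iJ2.
have -> : \bigcap_(i in [set` J1]) E1 i `&` \bigcap_(i in [set` J2]) E2 i =
    \bigcap_(i in [set` (J1 `|` J2)%fset]) E i.
  rewrite set_fsetU; apply/seteqP; split => t.
    move=> [t1 t2] i [|] /= iJ; first by rewrite /E iJ; exact: t1.
    by rewrite EJ2//; exact: t2.
  move=> tE; split => i /= iJ.
    by have := tE i; rewrite /E iJ; apply; left.
  by rewrite -EJ2//; apply: tE; right.
rewrite indF; last first.
  by move=> i; rewrite inE /E; case: ifPn => [/FE1|_ /= /FE2].
rewrite (big_fsetID _ (mem J1))/=; congr (_ * _)%E.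
- have -> : [fset x in (J1 `|` J2)%fset | x \in J1]%fset = J1.
    by apply/fsetP => i; rewrite !inE; case: (i \in J1); rewrite ?andbF.
  by rewrite indF//; apply: eq_big_seq => i iJ; rewrite /E iJ.
- have -> : [fset x in (J1 `|` J2)%fset | x \notin J1]%fset = J2.
    apply/fsetP => i; rewrite !inE.
    case: (boolP (i \in J1)) => iJ1 /=; last by rewrite andbT.
    by apply/esym/negP => /(J12 _ iJ1).
  by rewrite indF//; apply: eq_big_seq => i iJ; rewrite EJ2.
Qed.

(** The pi-lambda extension is applied twice, once on each side, starting from cylinders. *)
Lemma family_salgebra_indep (S1 S2 : set I) : S1 `&` S2 = set0 ->
  indep_sys (family_salgebra S1) (family_salgebra S2).
Proof.
have sub S : family_salgebra S `<=` <<s cylinder S >>.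
  apply: smallest_sub; first exact: smallest_sigma_algebra.
  move=> A [i Si FA]; apply: sub_sigma_algebra.
  exists [fset i]%fset, (fun=> A); split.
  - by rewrite set_fset1 => _ ->.
  - by move=> j; rewrite inE => /eqP ->.
  - by rewrite set_fset1 bigcap_set1.
move=> S12 A B /sub sA /sub sB; move: A B sA sB.
apply: indep_sys_salgebral => //.
  apply: smallest_sub; first exact: sigma_algebra_measurable.
  exact: cylinder_measurable.
apply/indep_sysC/indep_sys_salgebral => //.
by apply: cylinder_indep; rewrite setIC.
Qed.

(** Induction on the list of labels: the block of the first label is independent of the
    sigma-algebra generated by all the remaining blocks, because distinct labels have disjoint
    fibres under [h]. *)
Lemma mutual_independence_group (K : choiceType) (h : I -> K) :
  mutual_independence P (fun k => family_salgebra (h @^-1` [set k])).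
Proof.
move=> J E; rewrite bigcap_fset.
suff aux (s : seq K) (E' : K -> set T) : uniq s ->
    (forall k, k \in s -> family_salgebra (h @^-1` [set k]) (E' k)) ->
    P (\big[setI/setT]_(k <- s) E' k) = (\prod_(k <- s) P (E' k))%E.
  exact: aux.
elim: s E' => {J E} [E _ _|k s IH E /= /andP[ks us] FE].
  by rewrite !big_nil probability_setT.
rewrite !big_cons -(IH E us (fun i si => FE i (mem_behead (s := k :: s) si))).
apply: (@family_salgebra_indep (h @^-1` [set k]) (h @^-1` [set` s])).
- apply/seteqP; split => // i [/= -> ks'].
  by rewrite ks' in ks.
- by apply: FE; rewrite inE eqxx.
- rewrite big_seq; elim/big_ind: _ => //.
  + exact: (@measurableT _ (g_sigma_algebraType _)).
  + by move=> A B; exact: (@measurableI _ (g_sigma_algebraType _)).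
  + move=> k' k's.
    apply: (@family_salgebraS (h @^-1` [set k'])); first by move=> i /= ->.
    by apply: FE; rewrite inE k's orbT.
Qed.

End Family.
End Independence.

(** * Measurability and integration along the fibres of a countable-valued map *)

Section CountableValued.
Context d (T : measurableType d) (K : countType) (W : T -> K).
Hypothesis mW : forall k, measurable (W @^-1` [set k]).

(** The event is the countable union over [k] of its traces [E k] on [W = k]. Applied in a generated
    sigma-algebra, this is the measurability side of freezing. *)
Lemma measurable_diagonal (E : K -> set T) :
  (forall k, measurable (E k)) -> measurable [set t | E (W t) t].
Proof.
move=> mE.
have -> : [set t | E (W t) t] = \bigcup_k (W @^-1` [set k] `&` E k).
  by apply/seteqP; split => [t Et|t [k _ [/= <-]]] //; exists (W t).
apply: countable_bigcupT_measurable; first exact: countableP.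
by move=> k; exact: measurableI.
Qed.

Lemma measurable_preimage_countable (D : set K) : measurable (W @^-1` D).
Proof.
apply: (measurable_diagonal (E := fun k => [set _ | D k])) => k.
have [Dk|nDk] := pselect (D k).
  by rewrite (_ : [set _ | _] = setT)//; apply/seteqP; split.
by rewrite (_ : [set _ | _] = set0)//; apply/seteqP; split.
Qed.

Lemma measurable_fun_countable d' (V : measurableType d') (h : K -> V) :
  measurable_fun setT (fun t => h (W t)).
Proof.
by move=> _ D mD; rewrite setTI; exact: (measurable_preimage_countable (h @^-1` D)).
Qed.

End CountableValued.

Section Fibers.
Context d (T : measurableType d) (R : realType) (P : {measure set T -> \bar R}).

Lemma integral_nat_fibers (Z : T -> nat) (C : set T) (g : T -> \bar R) :
  (forall k, measurable (Z @^-1` [set k])) -> measurable C ->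
  measurable_fun setT g -> (forall t, 0 <= g t)%E ->
  (\int[P]_(t in C) g t =
   \sum_(0 <= k <oo) \int[P]_(t in C `&` Z @^-1` [set k]) g t)%E.
Proof.
move=> mZ mC mg g0.
have CE : C = \bigcup_k (C `&` Z @^-1` [set k]).
  by apply/seteqP; split => [t Ct|t [k _ []]] //; exists (Z t).
rewrite [in LHS]CE ge0_integral_bigcup//.
- by move=> k; exact: measurableI.
- exact: measurable_funTS.
- by move=> i j _ _ [t [[_ /= <-] [_ /= <-]]].
Qed.

Lemma eq_integral_fibers (K : countType) (W : T -> K) (C : set T)
    (g1 g2 : T -> \bar R) :
  (forall k, measurable (W @^-1` [set k])) -> measurable C ->
  measurable_fun setT g1 -> (forall t, 0 <= g1 t)%E ->
  measurable_fun setT g2 -> (forall t, 0 <= g2 t)%E ->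
  (forall k, \int[P]_(t in C `&` W @^-1` [set k]) g1 t =
             \int[P]_(t in C `&` W @^-1` [set k]) g2 t)%E ->
  (\int[P]_(t in C) g1 t = \int[P]_(t in C) g2 t)%E.
Proof.
move=> mW mC mg1 g10 mg2 g20 g12.
(* Encoding [K] in the natural numbers reduces to a series; a natural number that encodes no value
   of [W] has an empty fibre and contributes 0. *)
have mpW k : measurable ((fun t => choice.pickle (W t)) @^-1` [set k]).
  exact: (measurable_preimage_countable mW (choice.pickle @^-1` [set k])).
rewrite !(integral_nat_fibers mpW mC)//; apply: eq_eseriesr => n _.
have [[t Wt]|nW] := pselect (exists t, choice.pickle (W t) = n); last first.
  rewrite (_ : _ @^-1` _ = set0) ?setI0 ?integral_set0//.
  by apply/seteqP; split => // t /= Wt; apply: nW; exists t.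
rewrite (_ : _ @^-1` _ = W @^-1` [set W t])//.
apply/seteqP; split => [u /= Wu|u /= ->//].
by apply: (pcan_inj (@choice.pickleK K)); rewrite Wu Wt.
Qed.

Lemma integral_natE (Z : T -> nat) (C : set T) (psi : nat -> \bar R) :
  (forall k, measurable (Z @^-1` [set k])) -> measurable C ->
  (forall k, 0 <= psi k)%E ->
  (\int[P]_(t in C) psi (Z t) =
   \sum_(0 <= k <oo) psi k * P (C `&` Z @^-1` [set k]))%E.
Proof.
move=> mZ mC psi0; rewrite (integral_nat_fibers mZ mC)//; last first.
  exact: measurable_fun_countable.
apply: eq_eseriesr => k _.
rewrite (eq_integral (fun=> psi k)); last first.
  by move=> t; rewrite inE => -[_ /= ->].
by rewrite integral_cst//; exact: measurableI.
Qed.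

End Fibers.

Lemma integral_law d (T : measurableType d) (R : realType)
    (P : {measure set T -> \bar R}) (mu : {measure set nat -> \bar R})
    (Z : T -> nat) (psi : nat -> \bar R) :
  (forall k, measurable (Z @^-1` [set k])) ->
  (forall D, P (Z @^-1` D) = mu D) -> (forall k, 0 <= psi k)%E ->
  (\int[P]_t psi (Z t) = \int[mu]_k psi k)%E.
Proof.
move=> mZ ZE psi0.
rewrite (integral_natE _ mZ)// (@integral_natE _ _ _ mu id)//.
by apply: eq_eseriesr => k _; rewrite !setTI ZE.
Qed.

(** * Conditional expectations by freezing, and their almost sure uniqueness *)

Section Freezing.
Context d (T : measurableType d) (R : realType) (P : probability T R).

(** Expanding over the values of [Z], each term contains [P] of an intersection, from which the
    factor [P C] comes out by independence. *)
Lemma integral_indep (G H : set_system T) (C : set T) (Z : T -> nat)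
    (psi : nat -> \bar R) :
  G `<=` measurable -> H `<=` measurable -> indep_sys P G H ->
  G C -> (forall k, H (Z @^-1` [set k])) -> (forall k, 0 <= psi k)%E ->
  (\int[P]_(t in C) psi (Z t) = P C * \int[P]_t psi (Z t))%E.
Proof.
move=> Gm Hm GH GC HZ psi0.
have mZ k : measurable (Z @^-1` [set k]) by exact/Hm.
have mC : measurable C by exact: Gm.
rewrite !(integral_natE _ mZ)//.
rewrite -(fineK (fin_num_measure P _ mC)) -nneseriesZl; last first.
  by move=> k _; rewrite mule_ge0.
apply: eq_eseriesr => k _; rewrite setTI.
transitivity (psi k * (P C * P (Z @^-1` [set k])))%E.
  by congr (_ * _)%E; exact: GH.
by rewrite muleCA fineK//; exact: fin_num_measure.
Qed.

(** The proposed version is a function of [W], hence measurable. Its integral over [C] is checked on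
    each [W = k], where [Z (W t)] is [Z k] and [integral_indep] applies to the event [C] intersected
    with [W = k]. *)
Lemma condexp_freeze (K : countType) (g h : set_system T) (W : T -> K)
    (Z : K -> T -> nat) (psi : nat -> \bar R) :
  <<s g>> `<=` measurable -> <<s h>> `<=` measurable ->
  indep_sys P <<s g>> <<s h>> ->
  (forall k, <<s g>> (W @^-1` [set k])) ->
  (forall k j, <<s h>> (Z k @^-1` [set j])) -> (forall j, 0 <= psi j)%E ->
  is_condexp P <<s g>> (fun t => psi (Z (W t) t))
    (fun t => \int[P]_u psi (Z (W t) u))%E.
Proof.
move=> Gm Hm GH GW HZ psi0.
have mW k : measurable (W @^-1` [set k]) by exact/Gm.
have mZ k j : measurable (Z k @^-1` [set j]) by exact/Hm.
split.
- by move=> t; apply: integral_ge0.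
- move=> D _.
  exact: (@measurable_preimage_countable _ (g_sigma_algebraType g) _ _ GW
    [set k | D (\int[P]_u psi (Z k u))%E]).
- move=> C GC; have mC := Gm _ GC.
  apply: (eq_integral_fibers mW mC).
  + exact: (measurable_fun_countable mW (fun k => \int[P]_u psi (Z k u))%E).
  + by move=> t; apply: integral_ge0.
  + move=> _ D mD; rewrite setTI.
    apply: (measurable_diagonal mW (E := fun k => [set t | D (psi (Z k t))])).
    move=> k.
    exact: (measurable_preimage_countable (mZ k) [set j | D (psi j)]).
  + by [].
  + move=> k.
    have GCk : <<s g>> (C `&` W @^-1` [set k]).
      exact: (@measurableI _ (g_sigma_algebraType g) _ _ GC (GW k)).
    rewrite (eq_integral (fun=> \int[P]_u psi (Z k u))%E); last first.
      by move=> t; rewrite inE => -[_ /= ->].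
    rewrite integral_cst; last exact: Gm.
    rewrite muleC -(integral_indep Gm Hm GH)//.
    by apply: eq_integral => t; rewrite inE => -[_ /= ->].
Qed.

Lemma condprob_freeze (K : countType) (g h : set_system T) (W : T -> K)
    (E : K -> set T) :
  <<s g>> `<=` measurable -> <<s h>> `<=` measurable ->
  indep_sys P <<s g>> <<s h>> ->
  (forall k, <<s g>> (W @^-1` [set k])) -> (forall k, <<s h>> (E k)) ->
  is_condprob P <<s g>> [set t | E (W t) t] (fun t => P (E (W t))).
Proof.
move=> Gm Hm GH GW HE.
(* An event is treated as a variable with values 0 and 1 in [nat], and [psi] is the embedding into
   the reals. *)
have := @condexp_freeze K g h W (fun k t => (t \in E k) : nat)
  (fun j => j%:R%:E) Gm Hm GH GW.
have -> : (fun t => ((t \in E (W t)) : nat)%:R%:E : \bar R) =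
    fun t => (\1_[set t | E (W t) t] t)%:E.
  by apply/funext => t; rewrite indicE.
have -> : (fun t => \int[P]_u (((u \in E (W t)) : nat)%:R)%:E)%E =
    fun t => P (E (W t)).
  by apply/funext => t; rewrite integral_indic ?setIT//; exact/Hm.
apply => [k j|j]; last by rewrite lee_fin.
apply: (@measurable_preimage_countable _ (g_sigma_algebraType h) _
  (fun t => t \in E k) _ [set b | nat_of_bool b = j]) => -[].
- rewrite (_ : _ @^-1` _ = E k); first exact: HE.
  by apply/seteqP; split => t /=; [exact: set_mem|exact: mem_set].
- rewrite (_ : _ @^-1` _ = ~` E k).
    exact: (@measurableC _ (g_sigma_algebraType h) _ (HE k)).
  by apply/seteqP; split => t /=; [move/negbT; rewrite notin_setE|
    move=> nE; apply/negbTE; rewrite notin_setE].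
Qed.

(** Testing on the event where one function is strictly smaller than the other shows that this event
    is null; doing so in both directions gives equality. *)
Lemma ae_eq_salgebra (g : set_system T) (f1 f2 : T -> R) :
  <<s g>> `<=` measurable ->
  (forall t, 0 <= f1 t) -> (forall t, 0 <= f2 t) ->
  (forall D, measurable D -> <<s g>> ((EFin \o f1) @^-1` D)) ->
  (forall D, measurable D -> <<s g>> ((EFin \o f2) @^-1` D)) ->
  (\int[P]_t (f1 t)%:E < +oo)%E ->
  (forall C, <<s g>> C ->
    \int[P]_(t in C) (f1 t)%:E = \int[P]_(t in C) (f2 t)%:E)%E ->
  {ae P, forall t, f1 t = f2 t}.
Proof.
move=> Gm f10 f20 Gf1 Gf2 f1oo f12.
have ltN (h1 h2 : T -> R) : (forall t, 0 <= h1 t) -> (forall t, 0 <= h2 t) ->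
    (forall D, measurable D -> <<s g>> ((EFin \o h1) @^-1` D)) ->
    (forall D, measurable D -> <<s g>> ((EFin \o h2) @^-1` D)) ->
    (\int[P]_t (h1 t)%:E < +oo)%E ->
    (forall C, <<s g>> C ->
      \int[P]_(t in C) (h1 t)%:E = \int[P]_(t in C) (h2 t)%:E)%E ->
    {ae P, forall t, h1 t >= h2 t}.
  move=> h10 h20 Gh1 Gh2 h1oo h12.
  have Gmf (h : T -> R) :
      (forall D, measurable D -> <<s g>> ((EFin \o h) @^-1` D)) ->
      @measurable_fun _ _ (g_sigma_algebraType g) R setT h.
    by move=> Gh; apply/measurable_EFinP => _ D mD; rewrite setTI; exact: Gh.
  have mfm (h : T -> R) :
      (forall D, measurable D -> <<s g>> ((EFin \o h) @^-1` D)) ->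
      measurable_fun setT (EFin \o h).
    by move=> Gh _ D mD; rewrite setTI; apply: Gm; exact: Gh.
  pose C := [set t | h1 t < h2 t].
  have GC : <<s g>> C.
    rewrite (_ : C = setT `&` (fun t => h1 t < h2 t) @^-1` [set true]).
      exact: (measurable_fun_ltr (Gmf _ Gh1) (Gmf _ Gh2)).
    by rewrite setTI.
  have mC := Gm _ GC.
  have mh : measurable_fun C (fun t => (h2 t - h1 t)%:E).
    apply: measurable_funTS; apply/measurable_EFinP.
    by apply: measurable_funB; apply/measurable_EFinP; exact: mfm.
  (* Finiteness is what allows the integral of [h1] to be cancelled from both sides below. *)
  have h1C : (\int[P]_(t in C) (h1 t)%:E)%E \is a fin_num.
    rewrite ge0_fin_numE; last first.
      by apply: integral_ge0 => t _; rewrite lee_fin.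
    apply: le_lt_trans h1oo; apply: ge0_subset_integral => //.
    - exact: mfm.
    - by move=> t _; rewrite lee_fin.
  have iC : (\int[P]_(t in C) (h2 t - h1 t)%:E = 0)%E.
    have := h12 _ GC.
    rewrite [in X in _ = X -> _](eq_integral
      (fun t => (h1 t)%:E + (h2 t - h1 t)%:E)%E).
      rewrite ge0_integralD//; last first.
      - by move=> t Ct; rewrite lee_fin subr_ge0 ltW.
      - exact/measurable_funTS/mfm.
      - by move=> t _; rewrite lee_fin.
      move=> h1E; rewrite -[LHS](addeK _ h1C) [X in (X - _)%E]addeC -h1E.
      by rewrite subee.
    by move=> t _; rewrite -EFinD subrKC.
  have : (\int[P]_(t in C) `|(h2 t - h1 t)%:E| = 0)%E.
    rewrite -[RHS]iC; apply: eq_integral => t; rewrite inE => Ct.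
    by rewrite gee0_abs// lee_fin subr_ge0 ltW.
  move/(ae_eq_integral_abs P mC mh) => [N [mN PN0 CN]].
  exists N; split => // t /= /negP; rewrite -ltNge => Ct; apply: CN => /=.
  by move=> /(_ Ct)[] /eqP; rewrite subr_eq0 gt_eqF.
(* Testing on the whole space passes integrability from [f1] to [f2], so that the argument can be
   repeated with the roles exchanged. *)
have f2oo : (\int[P]_t (f2 t)%:E < +oo)%E.
  by rewrite -f12//; exact: (@measurableT _ (g_sigma_algebraType g)).
have le1 := ltN _ _ f10 f20 Gf1 Gf2 f1oo f12.
have le2 := ltN _ _ f20 f10 Gf2 Gf1 f2oo (fun C GC => esym (f12 C GC)).
by apply: filterS2 le1 le2 => t l1 l2; apply/le_anti/andP.
Qed.

End Freezing.

Lemma integral_probability_cst d (T : measurableType d) (R : realType)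
    (P : probability T R) (c : \bar R) : (\int[P]_t c = c)%E.
Proof.
transitivity (c * P setT)%E; first exact: integral_cst.
by rewrite probability_setT mule1.
Qed.

Lemma measurable_nat_sum d (T : measurableType d) (J : eqType)
    (f : J -> T -> nat) (s : seq J) (D : set nat) :
  (forall j, j \in s -> forall D', measurable (f j @^-1` D')) ->
  measurable [set t | D (\sum_(j <- s) f j t)%N].
Proof.
elim: s D => [|j s IH] D mf.
  have [D0|nD0] := pselect (D 0%N).
    by rewrite (_ : [set t | _] = setT)//; apply/seteqP; split => t;
      rewrite /= ?big_nil.
  by rewrite (_ : [set t | _] = set0)//; apply/seteqP; split => t;
    rewrite /= ?big_nil.
have -> : [set t | D (\sum_(i <- j :: s) f i t)%N] =
    [set t | [set u | D (f j t + \sum_(i <- s) f i u)%N] t].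
  by apply/seteqP; split => t /=; rewrite big_cons.
apply: (@measurable_diagonal _ _ _ (f j) _
  (fun k => [set u | D (k + \sum_(i <- s) f i u)%N])) => k.
  by apply: mf; rewrite inE eqxx.
apply: (IH [set n | D (k + n)%N]) => i si.
by apply: mf; rewrite inE si orbT.
Qed.

Lemma measurable_map_fiber d (T : measurableType d) (J : eqType) (K : eqType)
    (f : J -> T -> K) (s : seq J) (w : seq K) :
  (forall j, j \in s -> forall k, measurable (f j @^-1` [set k])) ->
  measurable ((fun t => [seq f j t | j <- s]) @^-1` [set w]).
Proof.
elim: s w => [|j s IH] [|k w] mf /=.
- by rewrite (_ : _ @^-1` _ = setT)//; apply/seteqP; split.
- by rewrite (_ : _ @^-1` _ = set0)//; apply/seteqP; split.
- by rewrite (_ : _ @^-1` _ = set0)//; apply/seteqP; split.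
- rewrite (_ : _ @^-1` _ =
    f j @^-1` [set k] `&` (fun t => [seq f i t | i <- s]) @^-1` [set w]).
    apply: measurableI; first by apply: mf; rewrite inE eqxx.
    by apply: IH => i si; apply: mf; rewrite inE si orbT.
  by apply/seteqP; split => t /= [-> ->].
Qed.

(** * Expectations of functions of a sum of independent copies *)

Section SumExpect.
Context (R : realType) (mu : probability nat R).

(* The expectation of [psi] at the sum of [n] independent variables of law
   [mu]. *)
Fixpoint sum_expect (n : nat) (psi : nat -> \bar R) : \bar R :=
  if n is n'.+1 then (\int[mu]_k sum_expect n' (fun j => psi (k + j)%N))%E
  else psi 0.

Lemma sum_expect_ge0 n (psi : nat -> \bar R) :
  (forall j, 0 <= psi j)%E -> (0 <= sum_expect n psi)%E.
Proof.
elim: n psi => //= n IH psi psi0; apply: integral_ge0 => k _.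
exact: IH.
Qed.

Lemma integral_pgf (s : R) : 0 <= s <= 1 ->
  (\int[mu]_k (s ^+ k)%:E = (pgf mu s)%:E)%E.
Proof.
move=> /andP[s0 s1]; rewrite /pgf fineK//.
rewrite ge0_fin_numE; last first.
  by apply: integral_ge0 => k _; rewrite lee_fin exprn_ge0.
apply: (@le_lt_trans _ _ (\int[mu]_k 1)%E); last first.
  by rewrite integral_probability_cst ltry.
apply: ge0_le_integral => //.
- by move=> k _; rewrite lee_fin exprn_ge0.
- by move=> k _; rewrite lee_fin exprn_ile1.
Qed.

Lemma pgf_itv (s : R) : 0 <= s <= 1 -> 0 <= pgf mu s <= 1.
Proof.
move=> s01; rewrite -!lee_fin -integral_pgf//.
case/andP: s01 => s0 s1.
apply/andP; split.
  by apply: integral_ge0 => k _; rewrite lee_fin exprn_ge0.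
apply: (@le_trans _ _ (\int[mu]_k 1)%E); last first.
  by rewrite integral_probability_cst.
apply: ge0_le_integral => //.
- by move=> k _; rewrite lee_fin exprn_ge0.
- by move=> k _; rewrite lee_fin exprn_ile1.
Qed.

Lemma sum_expect_pgf n (s : R) : 0 <= s <= 1 ->
  sum_expect n (fun j => (s ^+ j)%:E) = (pgf mu s ^+ n)%:E.
Proof.
move=> s01; have [s0 s1] := andP s01.
have [f0 _] := andP (pgf_itv s01).
(* The factor [c] collects the powers [s ^+ k] of the variables already split off, since each step
   of [sum_expect] shifts [psi]. *)
suff H (c : R) : 0 <= c ->
    sum_expect n (fun j => (c * s ^+ j)%:E) = (c * pgf mu s ^+ n)%:E.
  transitivity (sum_expect n (fun j => (1 * s ^+ j)%:E)).
    by congr sum_expect; apply/funext => j; rewrite mul1r.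
  by rewrite H// mul1r.
elim: n c => [|n IH] c c0; first by rewrite /= !expr0.
rewrite /=.
under eq_integral => k _.
  rewrite (_ : (fun j => _) = fun j => (c * s ^+ k * s ^+ j)%:E).
    rewrite IH; last by rewrite mulr_ge0// exprn_ge0.
    rewrite mulrAC EFinM; over.
  by apply/funext => j; rewrite exprD mulrA.
rewrite ge0_integralZl//.
- by rewrite integral_pgf// -EFinM exprSr mulrA.
- by move=> k _; rewrite lee_fin exprn_ge0.
- by rewrite lee_fin mulr_ge0// exprn_ge0.
Qed.

Lemma sum_expect_mean (m : R) n : 0 <= m -> nat_mean mu = m%:E ->
  sum_expect n (fun j => (j%:R)%:E) = (n%:R * m)%:E.
Proof.
move=> m0 mum.
(* Here [c] is the partial sum of the variables already split off. *)
suff H c : sum_expect n (fun j => ((c + j)%:R)%:E) = (c%:R + n%:R * m)%:E.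
  transitivity (sum_expect n (fun j => ((0 + j)%:R)%:E)) => //.
  by rewrite H add0r.
elim: n c => [|n IH] c; first by rewrite /= addn0 mul0r addr0.
rewrite /=.
under eq_integral => k _.
  rewrite (_ : (fun j => _) = fun j => ((c + k + j)%:R)%:E).
    rewrite IH natrD addrAC EFinD; over.
  by apply/funext => j; rewrite addnA.
rewrite ge0_integralD//; last first.
  by move=> k _; rewrite lee_fin addr_ge0// mulr_ge0.
rewrite integral_probability_cst.
rewrite -/(nat_mean mu) mum -EFinD -addrA; congr (_ + _)%:E.
by rewrite -[in RHS]natr1 mulrDl mul1r.
Qed.

End SumExpect.

(** * Sums over a randomly selected list of indices *)

Section RandomSum.
Context d (T : measurableType d) (R : realType) (P : probability T R).
Context (I : choiceType) (F : I -> set_system T).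
Hypothesis Fm : forall i, F i `<=` measurable.
Hypothesis FT : forall i, F i setT.
Hypothesis FI : forall i, setI_closed (F i).
Hypothesis indF : mutual_independence P F.
Variables (mu : probability nat R) (zeta : I -> T -> nat).

(** Independence is already carried by [indF]; what remains is that the indices are distinct and
    that each variable is measurable for its own member of [F] and has law [mu]. *)
Definition iid_on (s : seq I) : Prop :=
  uniq s /\ forall i, i \in s ->
    forall D, F i (zeta i @^-1` D) /\ P (zeta i @^-1` D) = mu D.

Lemma family_salgebra_sum (S : set I) (s : seq I) (D : set nat) :
  iid_on s -> (forall i, i \in s -> S i) ->
  family_salgebra F S [set t | D (\sum_(i <- s) zeta i t)%N].
Proof.
move=> [_ Fs] sS; apply: (@measurable_nat_sum _ (g_sigma_algebraType _)).
move=> i si D'; apply: (@sub_family_salgebra _ _ _ F S i); first exact: sS.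
by have [] := Fs i si D'.
Qed.

(** Freezing the first summand at [k] leaves a shorter sum with [psi] shifted by [k], which is the
    recursion defining [sum_expect]. *)
Lemma integral_iid_sum (s : seq I) (psi : nat -> \bar R) :
  iid_on s -> (forall j, 0 <= psi j)%E ->
  (\int[P]_t psi (\sum_(i <- s) zeta i t)%N = sum_expect mu (size s) psi)%E.
Proof.
elim: s psi => [|i s IH] psi [us Fs] psi0.
  under eq_integral do rewrite big_nil.
  by rewrite integral_probability_cst.
have [/= i_s us'] := andP us.
have iids : iid_on s.
  by split => // j sj D; apply: Fs; rewrite inE sj orbT.
have Fi D := Fs i (mem_head i s) D.
have S12 : [set i] `&` [set` s] = set0.
  by apply/seteqP; split => // j [/= -> js]; rewrite js in i_s.
have [_ _ /(_ setT)] := @condexp_freeze _ _ _ P _ _ _ (zeta i)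
  (fun k t => k + \sum_(j <- s) zeta j t)%N psi
  (family_salgebra_measurable Fm (S := [set i]))
  (family_salgebra_measurable Fm (S := [set` s]))
  (family_salgebra_indep Fm FT FI indF S12)
  (fun k => sub_family_salgebra (S := [set i]) erefl (proj1 (Fi [set k])))
  (fun k j => family_salgebra_sum [set n | (k + n)%N = j] iids (fun _ => id))
  psi0.
move=> /(_ (@measurableT _ (g_sigma_algebraType _))) E.
under eq_integral do rewrite big_cons.
rewrite -E /= -(@integral_law _ T R P mu (zeta i)
  (fun k => sum_expect mu (size s) (fun j => psi (k + j)%N))).
- by apply: eq_integral => t _; exact: (IH (fun j => psi (zeta i t + j)%N)).
- by move=> k; apply: (Fm (i := i)); exact: (proj1 (Fi [set k])).
- by move=> D; exact: (proj2 (Fi D)).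
- by move=> k; exact: sum_expect_ge0.
Qed.

(** Once [W] is frozen the list is deterministic and avoids [S], so its sum is independent of the
    conditioning, and only the length of the list enters the answer. *)
Lemma condexp_random_sum (K : countType) (S : set I) (W : T -> K)
    (s : K -> seq I) (psi : nat -> \bar R) :
  (forall k, family_salgebra F S (W @^-1` [set k])) ->
  (forall k, iid_on (s k)) -> (forall k i, i \in s k -> ~ S i) ->
  (forall j, 0 <= psi j)%E ->
  is_condexp P (family_salgebra F S)
    (fun t => psi (\sum_(i <- s (W t)) zeta i t)%N)
    (fun t => sum_expect mu (size (s (W t))) psi).
Proof.
move=> SW iids sS psi0.
have SC : S `&` ~` S = set0 by rewrite setICr.
have := @condexp_freeze _ _ _ P _ _ _ W
  (fun k t => \sum_(j <- s k) zeta j t)%N psi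
  (family_salgebra_measurable Fm (S := S))
  (family_salgebra_measurable Fm (S := ~` S))
  (family_salgebra_indep Fm FT FI indF SC) SW
  (fun k j => family_salgebra_sum [set j] (iids k) (sS k)) psi0.
by under [X in is_condexp _ _ _ X]eq_fun do rewrite integral_iid_sum//.
Qed.

Lemma integral_random_sum (K : countType) (S : set I) (W : T -> K)
    (s : K -> seq I) (psi : nat -> \bar R) :
  (forall k, family_salgebra F S (W @^-1` [set k])) ->
  (forall k, iid_on (s k)) -> (forall k i, i \in s k -> ~ S i) ->
  (forall j, 0 <= psi j)%E ->
  (\int[P]_t psi (\sum_(i <- s (W t)) zeta i t)%N =
   \int[P]_t sum_expect mu (size (s (W t))) psi)%E.
Proof.
move=> SW iids sS psi0.
have [_ _ /(_ setT) <-//] := condexp_random_sum SW iids sS psi0.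
exact: (@measurableT _ (g_sigma_algebraType _)).
Qed.

End RandomSum.

(** * Sigma-algebras of variables, and changing versions of conditional expectations *)

Section SigmaOf.
Context d (T : measurableType d).

Lemma sigma_of_measurable d' (V : measurableType d') (Z : T -> V) :
  measurable_fun setT Z -> sigma_of Z `<=` measurable.
Proof. by move=> mZ _ [D mD <-]; exact: mZ. Qed.

Lemma sigma_ofT d' (V : measurableType d') (Z : T -> V) : sigma_of Z setT.
Proof. by exists setT => //; rewrite setTI preimage_setT. Qed.

Lemma sigma_ofI d' (V : measurableType d') (Z : T -> V) :
  setI_closed (sigma_of Z).
Proof.
move=> _ _ [D mD <-] [D' mD' <-]; exists (D `&` D'); first exact: measurableI.
by rewrite !setTI preimage_setI.
Qed.

Lemma sigma_of_preimage d' (V : measurableType d') (Z : T -> V) (D : set V) :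
  measurable D -> sigma_of Z (Z @^-1` D).
Proof. by move=> mD; exists D => //; rewrite setTI. Qed.

(** The product sigma-algebra on pairs is discrete because each singleton is a rectangle and there
    are countably many of them. *)
Lemma measurable_set_nat2 (D : set (nat * nat)) : measurable D.
Proof.
apply: (@measurable_preimage_countable _ _ _ (@id (nat * nat)) _ D) => -[i j].
rewrite (_ : _ @^-1` _ = [set i] `*` [set j]); first exact: measurableX.
by apply/seteqP; split => -[a b] /=; [case=> -> ->|case=> /= -> ->].
Qed.

End SigmaOf.

Section ConditionalExpectation.
Context d (T : measurableType d) (R : realType) (P : probability T R).

(** The sigma-algebra is not completed, so an almost sure modification has to come with its own
    measurability. *)
Lemma condexp_ae (g : set_system T) (f : T -> \bar R) (f1 f2 : T -> R) :
  <<s g>> `<=` measurable -> is_condexp P <<s g>> f (EFin \o f1) ->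
  (forall t, 0 <= f2 t) ->
  @measurable_fun _ _ (g_sigma_algebraType g) R setT f2 ->
  {ae P, forall t, f1 t = f2 t} -> is_condexp P <<s g>> f (EFin \o f2).
Proof.
move=> Gm [f10 Gf1 f1E] f20 mf2 f12.
have Gf2 (D : set (\bar R)) : measurable D -> <<s g>> ((EFin \o f2) @^-1` D).
  move=> mD; rewrite -[X in <<s g>> X]setTI.
  by have /measurable_EFinP := mf2; apply.
split => //.
move=> C GC; rewrite -f1E//; apply: ge0_ae_eq_integral.
- exact: Gm.
- by apply: measurable_funTS => _ D mD; rewrite setTI; apply: Gm; exact: Gf2.
- by apply: measurable_funTS => _ D mD; rewrite setTI; apply: Gm; exact: Gf1.
- by move=> t _; rewrite /= lee_fin.
- by move=> t _; exact: f10.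
- by apply: filterS f12 => t f12t _; rewrite /= f12t.
Qed.

Lemma condexp_unique (g : set_system T) (f : T -> \bar R) (f1 f2 : T -> R) :
  <<s g>> `<=` measurable -> (\int[P]_t f t < +oo)%E ->
  is_condexp P <<s g>> f (EFin \o f1) -> is_condexp P <<s g>> f (EFin \o f2) ->
  {ae P, forall t, f1 t = f2 t}.
Proof.
move=> Gm foo [f10 Gf1 f1E] [f20 Gf2 f2E].
apply: (ae_eq_salgebra Gm _ _ Gf1 Gf2).
- by move=> t; rewrite -lee_fin; exact: f10.
- by move=> t; rewrite -lee_fin; exact: f20.
- rewrite f1E//; exact: (@measurableT _ (g_sigma_algebraType g)).
- by move=> C GC; rewrite [LHS]f1E// [RHS]f2E.
Qed.

Lemma probability_preimage_integral (Z : T -> nat) (D : set nat) :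
  (forall k, measurable (Z @^-1` [set k])) ->
  P (Z @^-1` D) = (\int[P]_t (\1_D (Z t))%:E)%E.
Proof.
move=> mZ; rewrite -[Z @^-1` D]setIT -integral_indic//.
exact: (measurable_preimage_countable mZ).
Qed.

End ConditionalExpectation.

Lemma sum_ord_map (J : Type) (c : nat -> J) (f : J -> nat) n :
  (\sum_(r < n) f (c r) = \sum_(j <- [seq c r | r <- iota 0 n]) f j)%N.
Proof. by rewrite big_map -(big_mkord xpredT (f \o c)) /index_iota subn0. Qed.

(** * Laws of the relabelled offspring and immigrant sums *)

Section Copies.
Context d (T : measurableType d) (R : realType) (P : probability T R).
Variables (mu nu : probability nat R) (L : nat -> nat -> {RV P >-> nat})
  (A B : nat -> {RV P >-> nat}).
Variables (xi1 : nat -> nat -> nat -> {RV P >-> nat})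
  (xi2 : nat -> nat -> {RV P >-> nat}).
Hypothesis L_law : forall n j D, P (L n j @^-1` D) = nu D.
Hypothesis copies : offspring_copies mu L A B xi1 xi2.

Let Y := offspring_sum L xi1.
Let eta := immigrant_sum xi2.

Definition copy_salgebra (i : copy_source) : set_system T :=
  match i with
  | CopyOffspring n j r => sigma_of (xi1 n j r)
  | CopyImmigrant n r => sigma_of (xi2 n r)
  | CopyControl n j => sigma_of (L n j)
  | CopyEnvironment n => sigma_of (fun t => (A n t, B n t))
  end.

(* The value at [CopyEnvironment] is a junk value. *)
Definition copy_value (i : copy_source) (t : T) : nat :=
  match i with
  | CopyOffspring n j r => xi1 n j r t
  | CopyImmigrant n r => xi2 n r t
  | CopyControl n j => L n j t
  | CopyEnvironment n => 0%N
  end.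

Definition is_copy (i : copy_source) : bool :=
  match i with
  | CopyOffspring _ _ _ | CopyImmigrant _ _ => true
  | _ => false
  end.

Lemma env_pair_measurable n : measurable_fun setT (fun t => (A n t, B n t)).
Proof. by apply/measurable_fun_pairP; split. Qed.

Lemma copy_salgebra_measurable i : copy_salgebra i `<=` measurable.
Proof.
by case: i => [n j r|n r|n j|n]; apply: sigma_of_measurable => //;
  exact: env_pair_measurable.
Qed.

Lemma copy_salgebraT i : copy_salgebra i setT.
Proof. by case: i => *; exact: sigma_ofT. Qed.

Lemma copy_salgebraI i : setI_closed (copy_salgebra i).
Proof. by case: i => *; exact: sigma_ofI. Qed.

Lemma copy_salgebra_indep : mutual_independence P copy_salgebra.
Proof. exact: copies_independence copies. Qed.

Let Fm := copy_salgebra_measurable.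
Let FT := copy_salgebraT.
Let FI := copy_salgebraI.
Let indF := copy_salgebra_indep.

Lemma iid_on_copies (s : seq copy_source) :
  uniq s -> {in s, forall i, is_copy i} ->
  iid_on P copy_salgebra mu copy_value s.
Proof.
move=> us sc; split => // i /sc; case: i => //= [n j r|n r] _ D; split.
- exact: sigma_of_preimage.
- exact: copies_offspring_law copies _ _ _ _.
- exact: sigma_of_preimage.
- exact: copies_immigrant_law copies _ _ _.
Qed.

Lemma env_sigma_copies :
  env_sigma A B = family_salgebra copy_salgebra (range CopyEnvironment).
Proof. by rewrite /env_sigma /family_salgebra bigcup_image. Qed.

Lemma env_sigma_measurable : env_sigma A B `<=` measurable.
Proof.
apply: smallest_sub; first exact: sigma_algebra_measurable.
by move=> C [n _]; exact/sigma_of_measurable/env_pair_measurable.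
Qed.

Lemma env_sigma_pair n (D : set (nat * nat)) :
  env_sigma A B [set t | D (A n t, B n t)].
Proof.
apply: sub_sigma_algebra; exists n => //.
by apply: sigma_of_preimage; exact: measurable_set_nat2.
Qed.

Definition offspring_copies_of (a n i l : nat) : seq copy_source :=
  [seq CopyOffspring n i r | r <- iota 0 (a * l)].

Definition immigrants_of (b n : nat) : seq copy_source :=
  [seq CopyImmigrant n r | r <- iota 0 b].

Lemma offspring_sumE a n i t :
  Y a n i t = (\sum_(c <- offspring_copies_of a n i (L n i t)) copy_value c t)%N.
Proof. exact: (sum_ord_map (CopyOffspring n i) (copy_value ^~ t)). Qed.

Lemma immigrant_sumE b n t :
  eta b n t = (\sum_(c <- immigrants_of b n) copy_value c t)%N.
Proof. exact: (sum_ord_map (CopyImmigrant n) (copy_value ^~ t)). Qed.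

Lemma iid_offspring_copies_of a n i l :
  iid_on P copy_salgebra mu copy_value (offspring_copies_of a n i l).
Proof.
apply: iid_on_copies; last by move=> _ /mapP[r _ ->].
by rewrite map_inj_uniq ?iota_uniq// => r r' [].
Qed.

Lemma iid_immigrants_of b n :
  iid_on P copy_salgebra mu copy_value (immigrants_of b n).
Proof.
apply: iid_on_copies; last by move=> _ /mapP[r _ ->].
by rewrite map_inj_uniq ?iota_uniq// => r r' [].
Qed.

(** Each label [Some k] gathers the sources that enter one variable Y or eta, the control variable
    included, so that distinct variables use disjoint blocks. The environment forms the block
    [None]. *)
Definition copy_group (i : copy_source) : option ((nat * nat) + nat) :=
  match i with
  | CopyOffspring n j _ => Some (inl (n, j))
  | CopyImmigrant n _ => Some (inr n)
  | CopyControl n j => Some (inl (n, j))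
  | CopyEnvironment _ => None
  end.

Definition group_salgebra (k : option ((nat * nat) + nat)) : set_system T :=
  family_salgebra copy_salgebra (copy_group @^-1` [set k]).

Lemma control_fiber (S : set copy_source) n i k : S (CopyControl n i) ->
  family_salgebra copy_salgebra S (L n i @^-1` [set k]).
Proof. by move/sub_family_salgebra; apply; exact: sigma_of_preimage. Qed.

Lemma offspring_group a n i (D : set nat) :
  group_salgebra (Some (inl (n, i))) (Y a n i @^-1` D).
Proof.
have -> : Y a n i @^-1` D = [set t | [set u |
    D (\sum_(c <- offspring_copies_of a n i (L n i t)) copy_value c u)%N] t].
  by apply/seteqP; split => t /=; rewrite offspring_sumE.
apply: (@measurable_diagonal _ (g_sigma_algebraType _) _ (L n i) _
  (fun l => [set u |
    D (\sum_(c <- offspring_copies_of a n i l) copy_value c u)%N])) => l.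
  exact: control_fiber.
apply: (family_salgebra_sum D (iid_offspring_copies_of a n i l)).
by move=> _ /mapP[r _ ->].
Qed.

Lemma immigrant_group b n (D : set nat) :
  group_salgebra (Some (inr n)) (eta b n @^-1` D).
Proof.
have -> : eta b n @^-1` D =
    [set t | D (\sum_(c <- immigrants_of b n) copy_value c t)%N].
  by apply/seteqP; split => t /=; rewrite immigrant_sumE.
apply: (family_salgebra_sum D (iid_immigrants_of b n)).
by move=> _ /mapP[r _ ->].
Qed.

Lemma group_env_indep k :
  indep_sys P (env_sigma A B) (group_salgebra (Some k)).
Proof.
rewrite env_sigma_copies; apply: (family_salgebra_indep Fm FT FI indF).
by apply/seteqP; split => // _ [[n _ <-] /=].
Qed.

Lemma group_measurable k : group_salgebra k `<=` measurable.
Proof. exact: family_salgebra_measurable. Qed.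

Lemma offspring_sum_measurable a n i (D : set nat) : measurable (Y a n i @^-1` D).
Proof. by apply: group_measurable; exact: offspring_group. Qed.

Lemma immigrant_sum_measurable b n (D : set nat) : measurable (eta b n @^-1` D).
Proof. by apply: group_measurable; exact: immigrant_group. Qed.

(** Freezing [L n i] at [l] leaves [a * l] copies of xi. The result depends neither on [n] nor on
    [i], which yields identity in law. *)
Lemma integral_offspring_sum a n i (psi : nat -> \bar R) :
  (forall j, 0 <= psi j)%E ->
  (\int[P]_t psi (Y a n i t) = \int[nu]_l sum_expect mu (a * l) psi)%E.
Proof.
move=> psi0.
under eq_integral do rewrite offspring_sumE.
rewrite (integral_random_sum Fm FT FI indF (mu := mu) (S := [set CopyControl n i])
  (s := offspring_copies_of a n i) _ (iid_offspring_copies_of a n i) _ psi0).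
- under eq_integral do rewrite size_map size_iota.
  apply: (integral_law (Z := L n i)
    (psi := fun l => sum_expect mu (a * l) psi)).
  + by move=> k; exact: measurable_funPTI.
  + exact: L_law.
  + by move=> l; exact: sum_expect_ge0.
- by move=> k; exact: control_fiber.
- by move=> k _ /mapP[r _ ->].
Qed.

Lemma integral_immigrant_sum b n (psi : nat -> \bar R) :
  (forall j, 0 <= psi j)%E ->
  (\int[P]_t psi (eta b n t) = sum_expect mu b psi)%E.
Proof.
move=> psi0.
under eq_integral do rewrite immigrant_sumE.
rewrite (integral_iid_sum Fm FT FI indF (iid_immigrants_of b n) psi0).
by rewrite size_map size_iota.
Qed.

Lemma offspring_sum_ident a n i (D : set nat) :
  P (Y a n i @^-1` D) = P (Y a 0 0 @^-1` D).
Proof.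
have E m j : P (Y a m j @^-1` D) =
    (\int[nu]_l sum_expect mu (a * l) (fun k => (\1_D k)%:E))%E.
  rewrite probability_preimage_integral; last first.
    by move=> k; exact: offspring_sum_measurable.
  by apply: (integral_offspring_sum a m j (psi := fun k => (\1_D k)%:E)).
by rewrite !E.
Qed.

Lemma immigrant_sum_ident b n (D : set nat) :
  P (eta b n @^-1` D) = P (eta b 0 @^-1` D).
Proof.
have E m : P (eta b m @^-1` D) = sum_expect mu b (fun k => (\1_D k)%:E).
  rewrite probability_preimage_integral; last first.
    by move=> k; exact: immigrant_sum_measurable.
  by apply: (integral_immigrant_sum b m (psi := fun k => (\1_D k)%:E)).
by rewrite !E.
Qed.

Lemma env_fiberA n k : env_sigma A B (A n @^-1` [set k]).
Proof. exact: (env_sigma_pair n [set p | p.1 = k]). Qed.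

Lemma env_fiberB n k : env_sigma A B (B n @^-1` [set k]).
Proof. exact: (env_sigma_pair n [set p | p.2 = k]). Qed.

Lemma offspring_sum_condprob n i (D : set nat) :
  is_condprob P (env_sigma A B) [set t | D (Y (A n t) n i t)]
    (fun t => P (Y (A n t) n i @^-1` D)).
Proof.
apply: (condprob_freeze (W := A n) (E := fun a => Y a n i @^-1` D)
  env_sigma_measurable (group_measurable (k := Some (inl (n, i))))).
- exact: group_env_indep.
- exact: env_fiberA.
- by move=> a; exact: offspring_group.
Qed.

Lemma immigrant_sum_condprob n (D : set nat) :
  is_condprob P (env_sigma A B) [set t | D (eta (B n t) n t)]
    (fun t => P (eta (B n t) n @^-1` D)).
Proof.
apply: (condprob_freeze (W := B n) (E := fun b => eta b n @^-1` D)
  env_sigma_measurable (group_measurable (k := Some (inr n)))).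
- exact: group_env_indep.
- exact: env_fiberB.
- by move=> b; exact: immigrant_group.
Qed.

(** Wald's identity: with [A n] frozen at [a] and [L n i] at [l], the mean is [a * l * m], and
    integrating over [l] replaces [l] by [lambda]. *)
Lemma offspring_mean (m lambda : R) n i : 0 <= m -> 0 <= lambda ->
  nat_mean mu = m%:E -> nat_mean nu = lambda%:E ->
  is_condexp P (env_sigma A B)
    (fun t => ((Y (A n t) n i t)%:R)%:E)
    (fun t => (m * lambda * (A n t)%:R)%:E).
Proof.
move=> m0 l0 mum nul.
have := @condexp_freeze _ _ _ P _ _ _ (A n) (fun a => Y a n i)
  (fun k => (k%:R)%:E) env_sigma_measurable
  (group_measurable (k := Some (inl (n, i))))
  (@group_env_indep _) (env_fiberA n)
  (fun a k => @offspring_group a n i [set k]) (fun k => ler0n R k).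
have E a : (\int[P]_u ((Y a n i u)%:R)%:E = (m * lambda * a%:R)%:E :> \bar R)%E.
  rewrite (integral_offspring_sum a n i (psi := fun k => (k%:R)%:E))//.
  under eq_integral do rewrite (sum_expect_mean _ m0 mum) natrM mulrAC EFinM.
  rewrite ge0_integralZl//; last by rewrite lee_fin mulr_ge0.
  by rewrite -/(nat_mean nu) nul -EFinM; congr EFin; rewrite [RHS]mulrC mulrA.
by under [X in is_condexp _ _ _ X]eq_fun do rewrite E.
Qed.

(** The environment is independent of the block of [Z], so the integral over [C] is [P C] times the
    full one and the normalisation cancels [P C]. *)
Lemma condexp_event_indep (C : set T) (Z : T -> nat) (s : R)
    (k : (nat * nat) + nat) (c : R) :
  env_sigma A B C -> (forall j, group_salgebra (Some k) (Z @^-1` [set j])) ->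
  0 <= s -> (0 < P C)%E -> (\int[P]_t (s ^+ Z t)%:E = c%:E)%E ->
  condexp_event P C (fun t => s ^+ Z t) = c.
Proof.
move=> GC GZ s0 PC0 Ec.
rewrite /condexp_event /Rintegral.
rewrite (@integral_indep _ _ _ P (env_sigma A B) (group_salgebra (Some k)) C Z
  (fun j => (s ^+ j)%:E) env_sigma_measurable (@group_measurable _)
  (@group_env_indep _) GC GZ); last by move=> j; rewrite lee_fin exprn_ge0.
have PCf : P C \is a fin_num.
  by apply: fin_num_measure; exact: env_sigma_measurable.
rewrite Ec fineM//= mulrC mulKf//.
by rewrite gt_eqF// fine_gt0// PC0 -ge0_fin_numE.
Qed.

Lemma offspring_pgf n i a (s : R) : 0 <= s <= 1 ->
  (\int[P]_t (s ^+ Y a n i t)%:E = (pgf nu (pgf mu s ^+ a))%:E)%E.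
Proof.
move=> s01; have [s0 s1] := andP s01; have [f0 f1] := andP (pgf_itv mu s01).
rewrite (integral_offspring_sum a n i (psi := fun k => (s ^+ k)%:E)); last first.
  by move=> j; rewrite lee_fin exprn_ge0.
under eq_integral do rewrite sum_expect_pgf// exprM.
by rewrite integral_pgf// exprn_ge0//= exprn_ile1.
Qed.

Lemma immigrant_pgf n b (s : R) : 0 <= s <= 1 ->
  (\int[P]_t (s ^+ eta b n t)%:E = (pgf mu s ^+ b)%:E)%E.
Proof.
move=> s01; have [s0 s1] := andP s01.
rewrite (integral_immigrant_sum b n (psi := fun k => (s ^+ k)%:E)).
  by rewrite sum_expect_pgf.
by move=> j; rewrite lee_fin exprn_ge0.
Qed.

End Copies.

(** * Conditional independence of the Y and eta given the environment *)

Section ConditionalIndependence.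
Context d (T : measurableType d) (R : realType) (P : probability T R).
Variables (mu : probability nat R) (L : nat -> nat -> {RV P >-> nat})
  (A B : nat -> {RV P >-> nat}).
Variables (xi1 : nat -> nat -> nat -> {RV P >-> nat})
  (xi2 : nat -> nat -> {RV P >-> nat}).
Hypothesis copies : offspring_copies mu L A B xi1 xi2.

Let Y := offspring_sum L xi1.
Let eta := immigrant_sum xi2.

Let param (i : (nat * nat) + nat) (t : T) : nat :=
  match i with inl (n, _) => A n t | inr n => B n t end.

(** The variable of index [i] is [var i] evaluated at the environment parameter [param i]; with its
    parameter frozen it belongs to the block [Some i]. *)
Let var (i : (nat * nat) + nat) (w : nat) : T -> nat :=
  match i with inl (n, j) => Y w n j | inr n => eta w n end.

Let param_fiber i k : env_sigma A B (param i @^-1` [set k]).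
Proof. by case: i => [[n j]|n]; [exact: env_fiberA|exact: env_fiberB]. Qed.

Let var_group i w (D : set nat) :
  group_salgebra L A B xi1 xi2 (Some i) (var i w @^-1` D).
Proof.
case: i => [[n j]|n]; [exact: (offspring_group copies)|
                       exact: (immigrant_group copies)].
Qed.

Let Fm := @copy_salgebra_measurable _ _ _ P L A B xi1 xi2.
Let FT := @copy_salgebraT _ _ _ P L A B xi1 xi2.
Let FI := @copy_salgebraI _ _ _ P L A B xi1 xi2.
Let indF := copy_salgebra_indep copies.

Let var_indep (J : {fset (nat * nat) + nat}) (w : (nat * nat) + nat -> nat)
    (D : (nat * nat) + nat -> set nat) :
  P (\bigcap_(i in [set` J]) (var i (w i) @^-1` D i)) =
  (\prod_(i <- J) P (var i (w i) @^-1` D i))%E.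
Proof.
apply: (mutual_independence_reindex (@Some_inj _)
  (mutual_independence_group Fm FT FI indF (h := copy_group))) => i _.
exact: var_group.
Qed.

(** Freezing the finitely many parameters involved gives the product formula for explicit versions
    [q]. The statement allows arbitrary versions [p], which are reached by almost sure
    uniqueness. *)
Lemma copies_conditional_independence :
  conditional_independence P (env_sigma A B)
    (fun i : (nat * nat) + nat => fun t =>
       match i with
       | inl (n, i) => Y (A n t) n i t
       | inr n => eta (B n t) n t
       end).
Proof.
move=> J D p pJ.
(* Finite sequences of naturals are countable, so all parameters can be frozen at once; the
   parameter of [i] is recovered at the position of [i] in the enumeration of [J]. *)
pose W t := [seq param i t | i <- enum_fset J].
pose E (w : seq nat) :=
  \bigcap_(i in [set` J]) (var i (nth 0%N w (index i (enum_fset J))) @^-1` D i).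
have WE i t : i \in J -> nth 0%N (W t) (index i (enum_fset J)) = param i t.
  move=> iJ; rewrite /W (nth_map i) ?nth_index ?index_mem//.
have ZE : \bigcap_(i in [set` J])
    ((fun t => match i with
       | inl (n, i) => Y (A n t) n i t
       | inr n => eta (B n t) n t
       end) @^-1` D i) = [set t | E (W t) t].
  apply/seteqP; split => t H i /= iJ; have := H i iJ; rewrite /= WE//.
    by case: i {iJ H} => [[n j]|n].
  by case: i {iJ H} => [[n j]|n].
pose q i t := fine (P (var i (param i t) @^-1` D i)).
have varm i w (D' : set nat) : measurable (var i w @^-1` D').
  by apply: (group_measurable (k := Some i)); exact: var_group.
have qE t : P (E (W t)) = (\prod_(i <- J) q i t)%:E.
  rewrite var_indep -prodEFin big_seq [RHS]big_seq.
  apply: eq_bigr => i iJ; rewrite fineK ?WE//.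
  by apply: fin_num_measure.
have Gm : env_sigma A B `<=` measurable by exact: env_sigma_measurable.
have Wfib w : env_sigma A B (W @^-1` [set w]).
  by apply: (@measurable_map_fiber _ (g_sigma_algebraType _)) => i _ k;
    exact: param_fiber.
have Egrp w : family_salgebra (copy_salgebra L A B xi1 xi2)
    (~` range CopyEnvironment) (E w).
  rewrite /E bigcap_fset; elim/big_ind: _ => //.
  - exact: (@measurableT _ (g_sigma_algebraType _)).
  - by move=> C C'; exact: (@measurableI _ (g_sigma_algebraType _)).
  - move=> i _; apply: (family_salgebraS _ (@var_group i _ (D i))).
    by move=> c /= + [n _ cE]; rewrite -cE.
have condE : is_condprob P (env_sigma A B) [set t | E (W t) t]
    (EFin \o (fun t => \prod_(i <- J) q i t)).
  rewrite (_ : EFin \o _ = fun t => P (E (W t))); last first.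
    by apply/funext => t; rewrite qE.
  apply: (condprob_freeze Gm
    (family_salgebra_measurable Fm (S := ~` range CopyEnvironment)) _ Wfib Egrp).
  have := family_salgebra_indep Fm FT FI indF (setICr (range CopyEnvironment)).
  by rewrite -env_sigma_copies.
have condq i : is_condprob P (env_sigma A B)
    [set t | (var i (param i t) @^-1` D i) t] (EFin \o q i).
  rewrite (_ : EFin \o _ = fun t => P (var i (param i t) @^-1` D i)).
    apply: (condprob_freeze (E := fun w => var i w @^-1` D i) Gm
      (group_measurable (k := Some i))).
    - exact: (group_env_indep copies).
    - exact: param_fiber.
    - by move=> w; exact: var_group.
  by apply/funext => t; rewrite /= fineK//; apply: fin_num_measure.
have pq i : i \in J -> {ae P, forall t, q i t = p i t}.
  move=> iJ; apply: (condexp_unique Gm _ (condq i)).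
    apply: (@le_lt_trans _ _ (\int[P]_t 1)%E); last first.
      by rewrite integral_probability_cst ltry.
    apply: ge0_le_integral => //.
    + apply/measurable_EFinP; apply: measurable_indic.
      apply: (measurable_diagonal (W := param i) _ (fun w => varm i w (D i))).
      by move=> w; apply: Gm; exact: param_fiber.
    + by move=> t _; rewrite lee_fin indicE; case: (_ \in _).
  have := pJ i iJ.
  by case: i {iJ} => [[n j]|n].
(* Only finitely many null sets are discarded, one for each factor. *)
have pqr (r : seq ((nat * nat) + nat)) : {subset r <= J} ->
    {ae P, forall t, \prod_(i <- r) q i t = \prod_(i <- r) p i t}.
  elim: r => [|i r IH] rJ.
    by apply: filterE => t; rewrite !big_nil.
  apply: filterS2 (pq i (rJ i (mem_head i r))) (IH _) => [t qp rqp|j rj].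
    by rewrite !big_cons qp rqp.
  by apply: rJ; rewrite inE rj orbT.
rewrite ZE; apply: (condexp_ae Gm condE _ _ (pqr _ (fun _ => id))).
- move=> t; rewrite big_seq; apply: prodr_ge0 => i iJ.
  by have [+ _ _] := pJ i iJ => /(_ t); rewrite lee_fin.
- apply: measurable_prod => i iJ; apply/measurable_EFinP => _ D' mD'.
  by rewrite setTI; have [_ + _] := pJ i iJ; apply.
Qed.

End ConditionalIndependence.

(** * The controlled process: Markov transitions and the quenched recursion *)

Section Process.
Context d (T : measurableType d) (R : realType) (P : probability T R).
Variables (mu nu : probability nat R) (m lambda : R)
  (xi L : nat -> nat -> {RV P >-> nat}) (A B X : nat -> {RV P >-> nat}).
Hypothesis hX : individual_sum_cbp mu nu m lambda xi L A B X.

Let Fs := cbp_source xi L A B X.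

(* Only the values at [Offspring] and [Control] matter. *)
Definition source_value (i : source) (t : T) : nat :=
  match i with
  | Offspring n j => xi n j t
  | Control n j => L n j t
  | _ => 0%N
  end.

Let Fm i : Fs i `<=` measurable.
Proof.
by case: i => [n j|n j|n|]; apply: sigma_of_measurable => //;
  exact: env_pair_measurable.
Qed.

Let FT i : Fs i setT. Proof. by case: i => *; exact: sigma_ofT. Qed.

Let FI i : setI_closed (Fs i). Proof. by case: i => *; exact: sigma_ofI. Qed.

Let indF : mutual_independence P Fs := cbp_independence hX.

Let env_sigma_source : env_sigma A B = family_salgebra Fs (range Environment).
Proof. by rewrite /env_sigma /family_salgebra bigcup_image. Qed.

(** The sources that determine the whole environment and [X 0], ..., [X n]; the step from [n] to
    [n.+1] uses the remaining ones once the state is frozen. *)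
Definition source_before (n : nat) : set source :=
  [set i | match i with
           | Offspring k _ | Control k _ => (k < n)%N
           | Environment _ | Initial => true
           end].

Lemma source_beforeS k n : (k <= n)%N -> source_before k `<=` source_before n.
Proof. by move=> kn [j r|j r|j|] //= /leq_trans; apply. Qed.

Definition offspring_of (n N : nat) : seq source :=
  [seq Offspring n j | j <- iota 0 N].

Definition controls_of (n x : nat) : seq source :=
  [seq Control n j | j <- iota 0 x].

Lemma iid_offspring_of n N : iid_on P Fs mu source_value (offspring_of n N).
Proof.
split; first by rewrite map_inj_uniq ?iota_uniq// => r r' [].
move=> _ /mapP[j _ ->] D; split; first exact: sigma_of_preimage.
exact: (cbp_offspring_law hX).
Qed.

Lemma iid_controls_of n x : iid_on P Fs nu source_value (controls_of n x).
Proof.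
split; first by rewrite map_inj_uniq ?iota_uniq// => r r' [].
move=> _ /mapP[j _ ->] D; split; first exact: sigma_of_preimage.
exact: (cbp_control_law hX).
Qed.

(* The state reached in one step from [w = (x, a, b)], i.e. from [X n = x] in
   the environment [(A n, B n) = (a, b)]. *)
Definition step (n : nat) (w : nat * nat * nat) (t : T) : nat :=
  (\sum_(j < w.1.2 * (\sum_(i < w.1.1) L n i t) + w.2) xi n j t)%N.

Definition state (n : nat) (t : T) : nat * nat * nat := (X n t, A n t, B n t).

Lemma step_state n t : X n.+1 t = step n (state n t) t.
Proof. exact: (cbp_rec hX). Qed.

Lemma stepE n x a b t : step n (x, a, b) t =
  (\sum_(i <- offspring_of n
     (a * (\sum_(i <- controls_of n x) source_value i t) + b))
     source_value i t)%N.
Proof.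
rewrite -(sum_ord_map (Offspring n) (source_value ^~ t)).
by rewrite -(sum_ord_map (Control n) (source_value ^~ t)).
Qed.

Lemma controls_fiber (S : set source) n x k : (forall j, S (Control n j)) ->
  family_salgebra Fs S
    ((fun t => \sum_(i <- controls_of n x) source_value i t)%N @^-1` [set k]).
Proof.
move=> Sn; apply: (family_salgebra_sum [set k] (iid_controls_of n x)).
by move=> _ /mapP[j _ ->].
Qed.

Lemma step_family_salgebra (S : set source) n w (D : set nat) :
  (forall j, S (Offspring n j)) -> (forall j, S (Control n j)) ->
  family_salgebra Fs S (step n w @^-1` D).
Proof.
case: w => -[x a] b So Sc.
have -> : step n (x, a, b) @^-1` D = [set t | [set u |
    D (\sum_(i <- offspring_of n
         (a * (\sum_(i <- controls_of n x) source_value i t) + b))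
         source_value i u)%N] t].
  by apply/seteqP; split => t /=; rewrite stepE.
apply: (@measurable_diagonal _ (g_sigma_algebraType _) _
  (fun t => \sum_(i <- controls_of n x) source_value i t)%N _
  (fun l => [set u | D (\sum_(i <- offspring_of n (a * l + b))
     source_value i u)%N])) => l; first exact: controls_fiber.
apply: (family_salgebra_sum D (iid_offspring_of n _)).
by move=> _ /mapP[r _ ->].
Qed.

Lemma step_measurable n w (D : set nat) : measurable (step n w @^-1` D).
Proof.
apply: (family_salgebra_measurable Fm (S := setT)).
exact: step_family_salgebra.
Qed.

Lemma env_family_salgebra n k (D : set (nat * nat)) :
  family_salgebra Fs (source_before n) [set t | D (A k t, B k t)].
Proof.
apply: (family_salgebraS (S := range Environment)); first by move=> _ [j _ <-].
by rewrite -env_sigma_source; exact: env_sigma_pair.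
Qed.

(** Stated over an arbitrary measurable space so that it applies with [T] carrying any of the
    generated sigma-algebras. *)
Lemma state_fiber (d' : measure_display) (V : measurableType d')
   (X' A' B' : V -> nat) w :
  (forall x, measurable (X' @^-1` [set x])) ->
  (forall p, measurable ((fun t => (A' t, B' t)) @^-1` [set p])) ->
  measurable ((fun t => (X' t, A' t, B' t)) @^-1` [set w]).
Proof.
case: w => -[x a] b mX mAB.
rewrite (_ : _ @^-1` _ =
  X' @^-1` [set x] `&` (fun t => (A' t, B' t)) @^-1` [set (a, b)]).
  exact: measurableI.
by apply/seteqP; split => t /=; [case=> -> -> ->|case=> -> [-> ->]].
Qed.

(** By induction [state n] is determined by the sources before [n], and for each frozen state the
    step uses only generation [n]; both lie before [n.+1]. *)
Lemma process_family_salgebra n (D : set nat) :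
  family_salgebra Fs (source_before n) (X n @^-1` D).
Proof.
elim: n D => [|n IH] D.
  by apply: (sub_family_salgebra (i := Initial)) => //; exact: sigma_of_preimage.
have -> : X n.+1 @^-1` D = [set t | (step n (state n t) @^-1` D) t].
  by apply/seteqP; split => t /=; rewrite step_state.
apply: (@measurable_diagonal _ (g_sigma_algebraType _) _ (state n) _
  (fun w => step n w @^-1` D)) => w.
  apply: (@state_fiber _ (g_sigma_algebraType _)) => [x|p].
    by apply: (family_salgebraS (source_beforeS (leqnSn n))); exact: IH.
  exact: (@env_family_salgebra n.+1 n [set p]).
by apply: step_family_salgebra => j /=.
Qed.

Lemma env_past_family_salgebra n :
  env_past_sigma A B X n `<=` family_salgebra Fs (source_before n).
Proof.
apply: smallest_sub; first exact: smallest_sigma_algebra.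
move=> C [[k _ [D mD <-]]|[k /= kn [D mD <-]]]; rewrite setTI.
  exact: env_family_salgebra.
by apply: (family_salgebraS (source_beforeS kn)); exact: process_family_salgebra.
Qed.

Lemma env_past_measurable n : env_past_sigma A B X n `<=` measurable.
Proof.
move=> C /env_past_family_salgebra; exact: family_salgebra_measurable.
Qed.

Lemma env_sigma_env_past n : env_sigma A B `<=` env_past_sigma A B X n.
Proof.
apply: smallest_sub; first exact: smallest_sigma_algebra.
by move=> C EC; apply: sub_sigma_algebra; left.
Qed.

Lemma env_past_state n w : env_past_sigma A B X n (state n @^-1` [set w]).
Proof.
apply: (@state_fiber _ (g_sigma_algebraType _)) => [x|p].
  apply: sub_sigma_algebra; right; exists n => //=.
  exact: sigma_of_preimage.
by apply: env_sigma_env_past; exact: (env_sigma_pair n [set p]).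
Qed.

Lemma env_past_indep n : indep_sys P (env_past_sigma A B X n)
  (family_salgebra Fs (~` source_before n)).
Proof.
move=> C D /env_past_family_salgebra GC GD.
by apply: (family_salgebra_indep Fm FT FI indF _ GC GD); rewrite setICr.
Qed.

Lemma step_future n w (D : set nat) :
  family_salgebra Fs (~` source_before n) (step n w @^-1` D).
Proof. by apply: step_family_salgebra => j /=; rewrite ltnn. Qed.

Lemma process_condprob n (D : set nat) :
  is_condprob P (env_past_sigma A B X n) (X n.+1 @^-1` D)
    (fun t => P (step n (state n t) @^-1` D)).
Proof.
have -> : X n.+1 @^-1` D = [set t | (step n (state n t) @^-1` D) t].
  by apply/seteqP; split => t /=; rewrite step_state.
apply: (condprob_freeze (W := state n) (E := fun w => step n w @^-1` D)
  (@env_past_measurable n)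
  (family_salgebra_measurable Fm (S := ~` source_before n))).
- exact: env_past_indep.
- exact: env_past_state.
- by move=> w; exact: step_future.
Qed.

(** Freezing the total of the control variables fixes the number of offspring terms. The right-hand
    side is the common form shared with [integral_copies_step]. *)
Lemma integral_step n x a b (psi : nat -> \bar R) :
  (forall j, 0 <= psi j)%E ->
  (\int[P]_t psi (step n (x, a, b) t) =
   \int[P]_t sum_expect mu (a * (\sum_(i < x) L n i t) + b) psi)%E.
Proof.
move=> psi0.
under eq_integral do rewrite stepE.
rewrite (integral_random_sum Fm FT FI indF (mu := mu)
  (S := range (Control n))
  (W := fun t => (\sum_(i <- controls_of n x) source_value i t)%N)
  (s := fun l => offspring_of n (a * l + b))
  _ (fun l => iid_offspring_of n _) _ psi0).
- apply: eq_integral => t _; rewrite size_map size_iota.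
  by rewrite -(sum_ord_map (Control n) (source_value ^~ t)).
- by move=> k; apply: controls_fiber => j; exists j.
- by move=> k _ /mapP[r _ ->] [].
Qed.

(** With control total [k], the inner expectation is [pgf mu s ^+ (a * k + b)]: the part in [b] is
    constant, and the rest is the generating function of [x] control variables at
    [pgf mu s ^+ a]. *)
Lemma step_pgf n x a b (s : R) : 0 <= s <= 1 ->
  (\int[P]_t (s ^+ step n (x, a, b) t)%:E =
   (pgf mu s ^+ b * pgf nu (pgf mu s ^+ a) ^+ x)%:E)%E.
Proof.
move=> s01; have [s0 s1] := andP s01; have [f0 f1] := andP (pgf_itv mu s01).
rewrite (integral_step n x a b (psi := fun k => (s ^+ k)%:E)); last first.
  by move=> j; rewrite lee_fin exprn_ge0.
under eq_integral => t _.
  rewrite sum_expect_pgf// exprD exprM mulrC EFinM.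
  rewrite (sum_ord_map (Control n) (source_value ^~ t)).
  over.
have mS k : measurable
    ((fun t => \sum_(i <- controls_of n x) source_value i t)%N @^-1` [set k]).
  apply: (family_salgebra_measurable Fm (S := setT)).
  exact: controls_fiber.
have fa0 : 0 <= pgf mu s ^+ a by rewrite exprn_ge0.
have fa1 : pgf mu s ^+ a <= 1 by rewrite exprn_ile1.
rewrite ge0_integralZl//.
- rewrite EFinM; congr (_ * _)%E.
  rewrite (integral_iid_sum Fm FT FI indF (iid_controls_of n x)
    (psi := fun k => ((pgf mu s ^+ a) ^+ k)%:E)); last first.
    by move=> j; rewrite lee_fin exprn_ge0.
  by rewrite size_map size_iota sum_expect_pgf// fa0.
- exact: (measurable_fun_countable mS (fun k => ((pgf mu s ^+ a) ^+ k)%:E)).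
- by move=> t _; rewrite lee_fin exprn_ge0.
- by rewrite lee_fin exprn_ge0.
Qed.

Lemma process_pgf n (s : R) : 0 <= s <= 1 ->
  is_condexp P (env_past_sigma A B X n) (fun t => (s ^+ X n.+1 t)%:E)
    (fun t => (pgf mu s ^+ B n t * pgf nu (pgf mu s ^+ A n t) ^+ X n t)%:E).
Proof.
move=> s01; have [s0 s1] := andP s01.
have := @condexp_freeze _ _ _ P _ _ _ (state n) (step n)
  (fun k => (s ^+ k)%:E) (@env_past_measurable n)
  (family_salgebra_measurable Fm (S := ~` source_before n))
  (@env_past_indep n) (@env_past_state n)
  (fun w k => @step_future n w [set k]) (fun k => exprn_ge0 k s0).
rewrite (_ : (fun t => (s ^+ step n (state n t) t)%:E) =
  fun t => (s ^+ X n.+1 t)%:E); last first.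
  by apply/funext => t; rewrite step_state.
by under [X in is_condexp _ _ _ X]eq_fun do rewrite step_pgf//.
Qed.

Lemma initial_condprob (D : set nat) :
  is_condprob P (env_sigma A B) (X 0 @^-1` D) (fun=> P (X 0 @^-1` D)).
Proof.
have indep0 : indep_sys P (env_sigma A B) (family_salgebra Fs [set Initial]).
  rewrite env_sigma_source; apply: (family_salgebra_indep Fm FT FI indF).
  by apply/seteqP; split => // _ [[n _ <-]].
apply: (condprob_freeze (W := fun=> tt) (E := fun=> X 0 @^-1` D)
  (@env_sigma_measurable _ _ _ P A B)
  (family_salgebra_measurable Fm (S := [set Initial])) indep0).
- move=> []; rewrite (_ : _ @^-1` _ = setT); last by apply/seteqP; split.
  exact: (@measurableT _ (g_sigma_algebraType _)).
- move=> _; apply: (sub_family_salgebra (i := Initial)) => //.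
  exact: sigma_of_preimage.
Qed.

(** Both sides are measurable for the environment, so it suffices to compare integrals over its
    events, where [process_pgf] brings generation [n.+1] back to generation [n]. *)
Lemma quenched_recursion (F : nat -> R -> T -> R) n (s : R) :
  quenched_pgf P A B X F -> 0 <= s <= 1 ->
  {ae P, forall t, F n.+1 s t =
    pgf mu s ^+ B n t * F n (pgf nu (pgf mu s ^+ A n t)) t}.
Proof.
move=> hF s01; have [f0 f1] := andP (pgf_itv mu s01).
pose l a := pgf nu (pgf mu s ^+ a).
have l01 a : 0 <= l a <= 1 by rewrite pgf_itv// exprn_ge0//= exprn_ile1.
have Gm := @env_sigma_measurable _ _ _ P A B.
have F0 k u t : 0 <= u <= 1 -> 0 <= F k u t.
  by move=> u01; have [+ _ _] := hF k u u01 => /(_ t); rewrite lee_fin.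
have GF k u D : 0 <= u <= 1 -> measurable D ->
    env_sigma A B ((EFin \o F k u) @^-1` D).
  by move=> u01 mD; have [_ + _] := hF k u u01; apply.
(* [F n] is evaluated at a random argument, but [l (A n t)] takes countably many values, so
   measurability reduces to that of [F n] at fixed arguments. *)
have GRHS D : measurable D -> env_sigma A B
    ((EFin \o (fun t => pgf mu s ^+ B n t * F n (l (A n t)) t)) @^-1` D).
  move=> mD.
  apply: (@measurable_diagonal _ (g_sigma_algebraType _) _
    (fun t => (A n t, B n t)) _
    (fun w => (EFin \o (fun t => pgf mu s ^+ w.2 * F n (l w.1) t)) @^-1` D)).
    by move=> w; exact: (env_sigma_pair n [set w]).
  move=> w; rewrite -[X in measurable X]setTI.
  have : @measurable_fun _ _
      (g_sigma_algebraType (\bigcup_k sigma_of (fun t => (A k t, B k t)))) R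
      setT (fun t => pgf mu s ^+ w.2 * F n (l w.1) t).
    apply: measurable_funM => //; apply/measurable_EFinP => _ D' mD'.
    by rewrite setTI; exact: GF.
  by move/measurable_EFinP; apply.
apply: (ae_eq_salgebra Gm _ _ (fun D => GF n.+1 s D s01) GRHS).
- by move=> t; exact: F0.
- by move=> t; rewrite mulr_ge0// ?exprn_ge0// F0.
- have [_ _ ->] := hF n.+1 s s01; last first.
    exact: (@measurableT _ (g_sigma_algebraType _)).
  apply: (@le_lt_trans _ _ (\int[P]_t 1)%E); last first.
    by rewrite integral_probability_cst ltry.
  have [s0 s1] := andP s01.
  apply: ge0_le_integral => //.
  + by move=> t _; rewrite lee_fin exprn_ge0.
  + apply: (measurable_fun_countable (W := X n.+1) _ (fun k => (s ^+ k)%:E)).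
    by move=> k; exact: measurable_funPTI.
  + by move=> t _; rewrite lee_fin exprn_ile1.
- move=> C GC.
  have [_ _ ->//] := hF n.+1 s s01.
  have [_ _ <-//] := process_pgf n s01; last exact: env_sigma_env_past.
  have mAB k : measurable ((fun t => (A n t, B n t)) @^-1` [set k]).
    by apply: Gm; exact: (env_sigma_pair n [set k]).
  (* On each event [(A n, B n) = (a, b)] the argument of [F n] is the fixed point [l a], where the
     defining property of [F n] applies. *)
  apply: (eq_integral_fibers mAB (Gm _ GC)).
  + apply: (measurable_fun_countable (W := state n) _
      (fun w => (pgf mu s ^+ w.2 * l w.1.2 ^+ w.1.1)%:E)).
    by move=> w; apply: (@env_past_measurable n); exact: env_past_state.
  + move=> t; rewrite lee_fin mulr_ge0// exprn_ge0//.
    by have [] := andP (l01 (A n t)).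
  + by move=> _ D mD; rewrite setTI; apply: Gm; exact: GRHS.
  + by move=> t; rewrite lee_fin mulr_ge0// ?exprn_ge0// F0.
  + move=> [a b].
    have GCab : env_sigma A B (C `&` (fun t => (A n t, B n t)) @^-1` [set (a, b)]).
      apply: (@measurableI _ (g_sigma_algebraType _) _ _ GC).
      exact: (env_sigma_pair n [set (a, b)]).
    have mCab := Gm _ GCab.
    rewrite (eq_integral (fun t => (pgf mu s ^+ b)%:E * (l a ^+ X n t)%:E)%E).
      rewrite [RHS](eq_integral (fun t => (pgf mu s ^+ b)%:E * (F n (l a) t)%:E)%E).
        rewrite !ge0_integralZl//.
        * by have [_ _ ->] := hF n (l a) (l01 a).
        * apply: measurable_funTS => _ D mD; rewrite setTI; apply: Gm; exact: GF.
        * by move=> t _; rewrite lee_fin F0.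
        * by rewrite lee_fin exprn_ge0.
        * apply: measurable_funTS.
          apply: (measurable_fun_countable (W := X n) _ (fun k => (l a ^+ k)%:E)).
          by move=> k; exact: measurable_funPTI.
        * by move=> t _; rewrite lee_fin exprn_ge0//; have [] := andP (l01 a).
        * by rewrite lee_fin exprn_ge0.
      by move=> t; rewrite inE => -[_ /= [-> ->]]; rewrite EFinM.
    by move=> t; rewrite inE => -[_ /= [-> ->]]; rewrite EFinM.
Qed.

End Process.

(** * The one-step law of the relabelled process *)

Section CopiesStep.
Context d (T : measurableType d) (R : realType) (P : probability T R).
Variables (mu : probability nat R) (L : nat -> nat -> {RV P >-> nat})
  (A B : nat -> {RV P >-> nat}).
Variables (xi1 : nat -> nat -> nat -> {RV P >-> nat})
  (xi2 : nat -> nat -> {RV P >-> nat}).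
Hypothesis copies : offspring_copies mu L A B xi1 xi2.

Let Y := offspring_sum L xi1.
Let eta := immigrant_sum xi2.

(** [w] holds frozen values of the control variables [L n i] for [i < x]; the default 0 only makes
    the list defined for every [w]. *)
Definition step_copies (n x a b : nat) (w : seq nat) : seq copy_source :=
  [seq CopyOffspring n i r | i <- iota 0 x, r <- iota 0 (a * nth 0%N w i)] ++
  immigrants_of b n.

Lemma iid_step_copies n x a b w :
  iid_on P (copy_salgebra L A B xi1 xi2) mu (copy_value L xi1 xi2)
    (step_copies n x a b w).
Proof.
apply: (iid_on_copies copies).
  rewrite cat_uniq; apply/and3P; split.
  - apply: allpairs_uniq_dep; rewrite ?iota_uniq//.
    + by move=> i _; exact: iota_uniq.
    + by move=> [i r] [i' r'] _ _ /= [-> ->].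
  - apply/hasPn => _ /mapP[r _ ->]; apply/negP => /allpairsPdep.
    by move=> [i [r' []]].
  - by rewrite map_inj_uniq ?iota_uniq// => r r' [].
move=> c; rewrite mem_cat => /orP[/allpairsPdep[i [r [_ _ ->]]]|] //.
by move=> /mapP[r _ ->].
Qed.

(** Freezing the control variables turns all the Y and eta together into one sum of distinct copies
    of xi, as many as in a step of the process. *)
Lemma integral_copies_step n x a b (psi : nat -> \bar R) :
  (forall j, 0 <= psi j)%E ->
  (\int[P]_t psi (\sum_(i < x) Y a n i t + eta b n t)%N =
   \int[P]_t sum_expect mu (a * (\sum_(i < x) L n i t) + b) psi)%E.
Proof.
move=> psi0.
pose W t := [seq L n i t | i <- iota 0 x].
have WE t (i : 'I_x) : nth 0%N (W t) i = L n i t.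
  by rewrite (nth_map 0%N) ?size_iota// nth_iota.
have sumE t : (\sum_(i < x) Y a n i t + eta b n t)%N =
    (\sum_(c <- step_copies n x a b (W t)) copy_value L xi1 xi2 c t)%N.
  rewrite big_cat /= /eta (immigrant_sumE L xi1 xi2); congr addn.
  rewrite big_allpairs_dep/= -[in RHS](subn0 x) big_mkord.
  apply: eq_bigr => i _; rewrite WE /Y (offspring_sumE L xi1 xi2).
  by rewrite big_map.
under eq_integral do rewrite sumE.
rewrite (integral_random_sum
  (@copy_salgebra_measurable _ _ _ P L A B xi1 xi2)
  (@copy_salgebraT _ _ _ P L A B xi1 xi2)
  (@copy_salgebraI _ _ _ P L A B xi1 xi2) (copy_salgebra_indep copies)
  (S := range (CopyControl n)) _ (iid_step_copies n x a b) _ psi0).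
- apply: eq_integral => t _; congr sum_expect.
  rewrite size_cat size_map size_iota size_allpairs_dep sumnE big_map.
  rewrite -[in LHS](subn0 x) big_mkord big_distrr/=; congr addn.
  by apply: eq_bigr => i _; rewrite size_iota WE.
- move=> w; apply: (@measurable_map_fiber _ (g_sigma_algebraType _)) => i _ k.
  by apply: control_fiber; exists i.
- move=> w c; rewrite mem_cat => /orP[/allpairsPdep[i [r [_ _ ->]]]|].
    by case.
  by move=> /mapP[r _ ->] [].
Qed.

Lemma copies_step_measurable n x a b (D : set nat) :
  measurable [set t | D (\sum_(i < x) Y a n i t + eta b n t)%N].
Proof.
apply: (@measurable_diagonal _ _ _ (eta b n) _
  (fun k => [set t | D (\sum_(i < x) Y a n i t + k)%N])) => k.
  exact: (immigrant_sum_measurable copies b n [set k]).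
apply: (@measurable_nat_sum _ _ _ _ _ [set j | D (j + k)%N]) => i _ D'.
exact: (offspring_sum_measurable copies).
Qed.

End CopiesStep.

(** * Existence of the relabelling, and assembly of the result *)

Lemma offspring_copies_exist d (T : measurableType d) (R : realType)
    (P : probability T R) (mu nu : probability nat R) (m lambda : R)
    (xi L : nat -> nat -> {RV P >-> nat}) (A B X : nat -> {RV P >-> nat}) :
  individual_sum_cbp mu nu m lambda xi L A B X ->
  exists (xi1 : nat -> nat -> nat -> {RV P >-> nat})
    (xi2 : nat -> nat -> {RV P >-> nat}), offspring_copies mu L A B xi1 xi2.
Proof.
move=> hX.
(* The injective code splits each row [xi n] into disjoint subfamilies, one for each individual and
   one for the immigrants, so the copies are the original variables with new labels. *)
have [code code_inj] : exists code : (nat * nat) + nat -> nat, injective code.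
  by exists choice.pickle; exact: (pcan_inj (@choice.pickleK _)).
exists (fun n i r => xi n (code (inl (i, r)))), (fun n r => xi n (code (inr r))).
split=> [n i r D|n r D|]; [exact: (cbp_offspring_law hX)..|].
pose c (i : copy_source) : source :=
  match i with
  | CopyOffspring n j r => Offspring n (code (inl (j, r)))
  | CopyImmigrant n r => Offspring n (code (inr r))
  | CopyControl n j => Control n j
  | CopyEnvironment n => Environment n
  end.
have c_inj : injective c.
  move=> [n j r|n r|n j|n] [n' j' r'|n' r'|n' j'|n'] //=.
  - by move=> [-> /code_inj[-> ->]].
  - by move=> [_ /code_inj].
  - by move=> [_ /code_inj].
  - by move=> [-> /code_inj[->]].
  - by move=> [-> ->].
  - by move=> [->].
rewrite (_ : (fun i => _) = fun i => cbp_source xi L A B X (c i)).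
  exact: mutual_independence_reindex c_inj (cbp_independence hX).
by apply/funext => -[].
Qed.

Theorem proposition4p13 (R : realType) (d : measure_display)
    (T : measurableType d) (P : probability T R)
    (mu nu : probability nat R) (m lambda : R)
    (xi L : nat -> nat -> {RV P >-> nat}) (A B X : nat -> {RV P >-> nat})
    (hX : individual_sum_cbp mu nu m lambda xi L A B X) :
  let f := pgf mu in
  let l := pgf nu in
  (exists (xi1 : nat -> nat -> nat -> {RV P >-> nat})
      (xi2 : nat -> nat -> {RV P >-> nat}),
      offspring_copies mu L A B xi1 xi2) /\
  (forall (xi1 : nat -> nat -> nat -> {RV P >-> nat})
      (xi2 : nat -> nat -> {RV P >-> nat}),
    offspring_copies mu L A B xi1 xi2 ->
    let Y := offspring_sum L xi1 in
    let eta := immigrant_sum xi2 in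
    [/\ bprei P A B X Y eta,
        (forall (n i a : nat) (s : R), 0 <= s <= 1 -> (0 < P (A n @^-1` [set a]))%E ->
          condexp_event P (A n @^-1` [set a]) (fun t => s ^+ Y a n i t) =
            l (f s ^+ a)),
        (forall (n b : nat) (s : R), 0 <= s <= 1 -> (0 < P (B n @^-1` [set b]))%E ->
          condexp_event P (B n @^-1` [set b]) (fun t => s ^+ eta b n t) =
            f s ^+ b) &
        (forall n i,
          is_condexp P (env_sigma A B)
            (fun t => ((Y (A n t) n i t)%:R)%:E)
            (fun t => (m * lambda * (A n t)%:R)%:E))]) /\
  (forall F : nat -> R -> T -> R, quenched_pgf P A B X F ->
    forall (n : nat) (s : R), 0 <= s <= 1 ->
      {ae P, forall t,
        F n.+1 s t = f s ^+ B n t * F n (l (f s ^+ A n t)) t}).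
Proof.
move=> f l; split; first exact: offspring_copies_exist hX.
split; last by move=> F hF n s; exact: (quenched_recursion hX).
move=> xi1 xi2 copies Y eta; have L_law := cbp_control_law hX.
split.
- split.
  + by move=> a n i D; exact: (offspring_sum_ident L_law copies).
  + by move=> b n D; exact: (immigrant_sum_ident copies).
  + by move=> n i D; exact: (offspring_sum_condprob copies).
  + by move=> n D; exact: (immigrant_sum_condprob copies).
  + exact: copies_conditional_independence copies.
  + exact: initial_condprob hX.
  + move=> n D.
    (* It remains to match two transition laws for each frozen state: both are written as integrals
       of an indicator and reduced to the same expectation over the control variables. *)
    rewrite (_ : (fun t => P [set u | _]) =
        fun t => P (step xi L n (state A B X n t) @^-1` D)).
      exact: process_condprob hX n D.
    apply/funext => t; rewrite /state.
    set Z := fun u => (\sum_(i < X n t) Y (A n t) n i u + eta (B n t) n u)%N.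
    have mZ D' : measurable (Z @^-1` D').
      exact: (copies_step_measurable copies n _ _ _ D').
    rewrite -[[set u | _]]/(Z @^-1` D).
    rewrite probability_preimage_integral// probability_preimage_integral; last first.
      by move=> k; exact: (step_measurable hX).
    rewrite (integral_step hX n _ _ _ (psi := fun k => (\1_D k)%:E))//.
    exact: (integral_copies_step copies n _ _ _ (psi := fun k => (\1_D k)%:E)).
- move=> n i a s s01 PA.
  apply: (condexp_event_indep copies (k := inl (n, i))) => //.
  + exact: env_fiberA.
  + by move=> j; exact: (offspring_group copies).
  + by case/andP: s01.
  + exact: (offspring_pgf L_law copies).
- move=> n b s s01 PB.
  apply: (condexp_event_indep copies (k := inr n)) => //.
  + exact: env_fiberB.
  + by move=> j; exact: (immigrant_group copies).
  + by case/andP: s01.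
  + exact: (immigrant_pgf copies).
- move=> n i; apply: (offspring_mean L_law copies).
  + exact: ltW (cbp_mean_gt0 hX).
  + exact: ltW (cbp_control_mean_gt0 hX).
  + exact: cbp_mean hX.
  + exact: cbp_control_mean hX.
Qed.
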